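(* For every integer $n\ge 3$, the class of graphs with no vertex-minor isomorphic to the cycle $C_n$ is polynomially $\chi$-bounded.
   Context: $C_n$ is the cycle graph on $n$ vertices. For a vertex $v$ of a graph $G$, the local complementation $G*v$ is the graph on $V(G)$ in which distinct $x,y$ are adjacent iff exactly one of the following holds: both $x$ and $y$ are neighbors of $v$ in $G$; $x$ is adjacent to $y$ in $G$. A graph $H$ is a vertex-minor of $G$ if $H$ is an induced subgraph of a graph obtained from $G$ by a sequence of local complementations. A class $\mathcal G$ of graphs is polynomially $\chi$-bounded if there is a polynomial $f$ such that for every $G\in\mathcal G$ and every induced subgraph $H$ of $G$, $\chi(H)\le f(\omega(H))$. *)

(* Defs.v *)
From HB Require Import structures.
From mathcomp Require Import all_boot all_order all_algebra.

Set Implicit Arguments.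
Unset Strict Implicit.
Unset Printing Implicit Defensive.

Import Order.TTheory GRing.Theory Num.Theory.

Record sgraph := SGraph {
  svertex :> finType;
  adj : rel svertex;
  adj_sym : symmetric adj;
  adj_irrefl : irreflexive adj }.

Arguments adj {s} x y : rename.

Definition isomorphic (G H : sgraph) : Prop :=
  exists2 f : G -> H, bijective f & {mono f : x y / adj x y}.

Section LocalComplement.
Variables (G : sgraph) (v : G).

Definition local_complement_adj : rel G :=
  fun x y => (x != y) && ((adj v x && adj v y) (+) adj x y).

Fact local_complement_sym : symmetric local_complement_adj.
Proof.
move=> x y; rewrite /local_complement_adj eq_sym (adj_sym x y).
by rewrite (andbC (adj v x)).
Qed.

Fact local_complement_irrefl : irreflexive local_complement_adj.
Proof. by move=> x; rewrite /local_complement_adj eqxx. Qed.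

Definition local_complement : sgraph :=
  SGraph local_complement_sym local_complement_irrefl.
End LocalComplement.

Section Induced.
Variables (G : sgraph) (S : {set G}).

Definition induced_adj : rel {x : G | x \in S} :=
  fun x y => adj (val x) (val y).

Fact induced_sym : symmetric induced_adj.
Proof. by move=> x y; rewrite /induced_adj adj_sym. Qed.

Fact induced_irrefl : irreflexive induced_adj.
Proof. by move=> x; rewrite /induced_adj adj_irrefl. Qed.

Definition induced : sgraph := SGraph induced_sym induced_irrefl.
End Induced.

Inductive locally_equivalent (G : sgraph) : sgraph -> Prop :=
| locally_equivalent_refl : locally_equivalent G G
| locally_equivalent_step (G' : sgraph) (v : G') :
    locally_equivalent G G' -> locally_equivalent G (local_complement v).

(* Taken up to isomorphism: [H] need not live on a subset of the vertices
   of [G]. *)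
Definition vertex_minor (H G : sgraph) : Prop :=
  exists2 G' : sgraph, locally_equivalent G G' &
    exists S : {set G'}, isomorphic H (induced S).

Section CycleGraph.
Variable n : nat.

(* [ordS] is the successor modulo [n].  The conjunct [i != j] only matters for
   [n = 1], where [ordS] has a fixed point; the cycle is meant for [n >= 3]. *)
Definition cycle_adj : rel 'I_n :=
  fun i j => (i != j) && ((j == ordS i) || (i == ordS j)).

Fact cycle_sym : symmetric cycle_adj.
Proof. by move=> i j; rewrite /cycle_adj eq_sym orbC. Qed.

Fact cycle_irrefl : irreflexive cycle_adj.
Proof. by move=> i; rewrite /cycle_adj eqxx. Qed.

Definition cycle_graph : sgraph := SGraph cycle_sym cycle_irrefl.
End CycleGraph.

Definition clique (G : sgraph) (K : {set G}) : bool :=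
  [forall x in K, forall y in K, (x != y) ==> adj x y].

Definition clique_number (G : sgraph) : nat :=
  \max_(K : {set G} | clique K) #|K|.

Definition colorable (G : sgraph) (k : nat) : bool :=
  [exists c : {ffun G -> 'I_k},
    [forall x, forall y, adj x y ==> (c x != c y)]].

Fact colorable_exists (G : sgraph) : exists k, colorable G k.
Proof.
exists #|G|; apply/existsP; exists [ffun x => enum_rank x].
apply/forallP=> x; apply/forallP=> y; apply/implyP=> xy.
rewrite !ffunE (inj_eq enum_rank_inj).
by apply: contraTneq xy => ->; rewrite adj_irrefl.
Qed.

Definition chromatic_number (G : sgraph) : nat := ex_minn (colorable_exists G).

(* Integer coefficients lose no generality: on the naturals, a real polynomial
   is bounded above by the integer polynomial obtained by rounding up its
   coefficients. *)
Definition polynomially_chi_bounded (C : sgraph -> Prop) : Prop :=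
  exists f : {poly int}, forall G : sgraph, C G -> forall S : {set G},
    ((chromatic_number (induced S))%:Z <=
       f.[(clique_number (induced S))%:Z])%R.

(* Main.v *)
Require Import Defs.
From HB Require Import structures.
From mathcomp Require Import all_boot all_order all_algebra.
From mathcomp Require Import zify.

Set Implicit Arguments.
Unset Strict Implicit.
Unset Printing Implicit Defensive.

(* Let G have no vertex-minor C_n.  A long hole, an induced path seen often by
   one vertex, and several ordered configurations all yield C_n by local
   complementations.  A Gyarfas path argument in the layers of a breadth-first
   search therefore bounds chi(G) by an affine function of the largest chi(N(v)),
   and it remains to bound chi(S) polynomially in omega(S) for S inside N(v).
   There, local complementation at v complements S, so S has neither long
   induced paths nor long induced co-paths.  If moreover S is prime for modular
   decomposition, the absence of long nested sequences of edges and non-edges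
   (spines) forces every U in S with chi(U) > 1 to contain two subsets complete
   to each other, each of chromatic number at least a constant fraction of
   chi(U); hence chi(U) <= omega(U)^d.  For general S, homogeneous sets are
   substituted by weighted vertices: by induction one assigns to every vertex x
   a set of w(x)^C colours out of omega_w(S)^C ones, with disjoint sets on
   adjacent vertices. *)

(** * Local complementation, induced paths and holes *)

(** Long spines alone force no cycle: threshold graphs contain arbitrarily long ones, yet they are
    cographs, and for n >= 5 no vertex-minor of a cograph is C_n. Hence the detour through modular
    primes. There every proper subset with at least two vertices is mixed by some outside vertex, so
    the set of vertices behind a long spine can be enlarged again and again, each time at the cost
    of boundedly many pairs; the mixing vertices met on the way form a chain, and long chains do
    yield C_n. The price is a substitution argument, and a bound chi <= omega^d for primes does not
    survive nested substitutions with the same d. The induction therefore carries a statement that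
    reproduces itself: a homogeneous set X becomes one vertex of weight omega_w(X), which receives
    omega_w(X)^C colours, exactly the palette that X needs. What remains is a prime with arbitrary
    weights, for which C = 4d + 5 leaves enough room to colour the dyadic weight classes one by
    one. *)

Record graph (T : finType) := Graph {
  gadj :> rel T;
  gsym : symmetric gadj;
  girr : irreflexive gadj }.

Section LocalComplementation.
Variable T : finType.
Implicit Types (e : graph T) (v x y : T).

Definition lc_rel e v : rel T :=
  fun x y => (x != y) && ((e v x && e v y) (+) e x y).

Fact lc_sym e v : symmetric (lc_rel e v).
Proof.
by move=> x y; rewrite /lc_rel eq_sym (gsym e x y) (andbC (e v x)).
Qed.

Fact lc_irr e v : irreflexive (lc_rel e v).
Proof. by move=> x; rewrite /lc_rel eqxx. Qed.

(* Locked, so that conversion does not unfold iterated complementations. *)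
Fact lc_key : unit. Proof. exact: tt. Qed.
Definition lc e v := locked_with lc_key (Graph (lc_sym e v) (lc_irr e v)).

Lemma lcE e v x y : x != y -> lc e v x y = (e v x && e v y) (+) e x y.
Proof. by move=> xy; rewrite /lc unlock /= /lc_rel xy. Qed.

Lemma lc_id e v x y : (e v x -> e v y -> x = y) -> lc e v x y = e x y.
Proof.
rewrite /lc unlock /= /lc_rel; case: eqP => [->|xy vxy]; first by rewrite girr.
by case vx: (e v x); case vy: (e v y) => //; case: xy; apply: vxy.
Qed.

Lemma lc_self e v x : lc e v v x = e v x.
Proof. by apply: lc_id; rewrite girr. Qed.

Lemma lc_flip e v x y : x != y -> e v x -> e v y -> lc e v x y = ~~ e x y.
Proof. by move=> xy vx vy; rewrite lcE // vx vy. Qed.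

Lemma adj_neq e x y : e x y -> x != y.
Proof. by apply: contraTneq => ->; rewrite girr. Qed.

Variable n : nat.

(* Cycles among vertex-minors, without changing the carrier: induced subgraphs
   commute with local complementations, so the restriction is taken last. *)
Definition has_cycle e :=
  exists vs, exists2 f : 'I_n -> T, injective f &
    forall i j, foldl lc e vs (f i) (f j) = cycle_adj i j.

Lemma has_cycle_lc e v : has_cycle (lc e v) -> has_cycle e.
Proof. by case=> vs [f fI fE]; exists (v :: vs), f. Qed.

(** The default of [head] is harmless: when it is returned, [all] ranges over the empty list. *)
Fixpoint ipath e s :=
  if s is x :: s' then
    [&& x \notin s', all (fun y => e x y == (y == head x s')) s' & ipath e s']
  else true.

Lemma ipath_cons e x s : ipath e (x :: s) =
  [&& x \notin s, all (fun y => e x y == (y == head x s)) s & ipath e s].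
Proof. by []. Qed.

Arguments ipath : simpl never.

Lemma ipath_uniq e s : ipath e s -> uniq s.
Proof. by elim: s => //= x s IH /and3P[-> _ /IH]. Qed.

Lemma eq_ipath e e' s :
  {in s &, forall x y, e x y = e' x y} -> ipath e s = ipath e' s.
Proof.
elim: s => // x s IH eqe; rewrite !ipath_cons IH; last first.
  by move=> y z ys zs; apply: eqe; rewrite inE ?ys ?zs orbT.
congr [&& _, _ & _]; apply: eq_in_all => y ys.
by rewrite eqe // inE ?eqxx // ys orbT.
Qed.

Lemma ipath_cat e s1 s2 : ipath e (s1 ++ s2) <->
  [/\ ipath e s1, ipath e s2 &
   {in s1 & s2, forall x y,
      x != y /\ e x y = (last y s1 == x) && (head x s2 == y)}].
Proof.
elim: s1 => [|x [|z s] IH]; first by split=> [|[]].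
  rewrite /=; split=> [/and3P[xs2 /allP a p]|[_ p c]].
    split=> // u y; rewrite inE => /eqP-> ys; split.
      by apply: contraNneq xs2 => ->.
    by rewrite (eqP (a y ys)) eqxx eq_sym; case: (s2) ys.
  apply/and3P; split=> //.
    by apply/negP=> xs2; have [] := c x x (mem_head _ _) xs2; rewrite eqxx.
  apply/allP=> y ys; have [_ ->] := c x y (mem_head _ _) ys.
  by rewrite /= eqxx [head _ _ == _]eq_sym /=.
rewrite cat_cons !(ipath_cons _ x); split.
  case/and3P=> xs /allP a p; have zs2: z \notin s2.
    by move: (ipath_uniq p) => /= /andP[]; rewrite mem_cat negb_or => /andP[].
  case/IH: p => p1 p2 c.
  have aE y : y \in z :: s ++ s2 -> e x y = (y == z) by move/a/eqP.
  split=> //.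
    rewrite p1 andbT; apply/andP; split.
      by apply: contra xs; rewrite !inE mem_cat orbA => ->.
    by apply/allP=> y ys; rewrite aE // !inE mem_cat orbA -in_cons ys.
  move=> u y; rewrite inE => /orP[/eqP->|us] ys; last exact: c.
  split; first by apply: contraNneq xs => ->; rewrite inE mem_cat ys !orbT.
  rewrite aE ?inE ?mem_cat ?ys ?orbT //=.
  rewrite (_ : (last z s == x) = false); last first.
    apply/negbTE; apply: contraNneq xs => <-.
    by rewrite mem_cat mem_last.
  by apply/negbTE; apply: contraNneq zs2 => <-.
case=> /and3P[xs /allP a p1] p2 c.
have cx y : y \in s2 -> x != y /\ e x y = false.
  move=> ys; have [xy ->] := c x y (mem_head _ _) ys; split=> //.
  rewrite (_ : (last z s == x) = false) //.
  by apply/negbTE; apply: contraNneq xs => <-; rewrite mem_last.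
apply/and3P; split.
- rewrite mem_cat negb_or xs.
  by apply/negP=> /cx[]; rewrite eqxx.
- apply/allP=> y; rewrite mem_cat => /orP[/a//|ys].
  have [_ ->] := cx y ys; rewrite eq_sym; apply/eqP/negbTE.
  by rewrite eq_sym; have [] := c z y; rewrite ?inE ?eqxx ?orbT.
- by apply/IH; split=> // u y us ys; apply: c; rewrite // inE us orbT.
Qed.

Lemma ipath_catl e s1 s2 : ipath e (s1 ++ s2) -> ipath e s1.
Proof. by case/ipath_cat. Qed.

Lemma ipath_catr e s1 s2 : ipath e (s1 ++ s2) -> ipath e s2.
Proof. by case/ipath_cat. Qed.

Lemma ipath_nth e s x0 i j : ipath e s -> i < j -> j < size s ->
  e (nth x0 s i) (nth x0 s j) = (j == i.+1).
Proof.
elim: s i j => // x s IH [|i] [|j] // /and3P[_ /allP a p] ij; rewrite [size _]/= ltnS => js /=.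
  rewrite (eqP (a _ (mem_nth _ js))) -nth0 eqSS [in RHS]eq_sym.
  rewrite (set_nth_default x0 x (leq_ltn_trans _ js)) // nth_uniq ?(ipath_uniq p) //.
  exact: leq_ltn_trans js.
exact: IH.
Qed.

(** On the path [w] sees only [p] and [q], so complementing at [w] joins these two and changes
    nothing else. *)
Lemma ipath_contract e a p w q b :
  ipath e (a ++ [:: p, w, q & b]) -> ipath (lc e w) (a ++ [:: p, q & b]).
Proof.
rewrite -!(cat_rcons p) => /ipath_cat[p1 /and3P[wqb /allP aw p2] c].
have ew1 x : x \in rcons a p -> e w x -> x = p.
  move=> xa; have [_] := c _ _ xa (mem_head _ _).
  by rewrite gsym => ->; rewrite last_rcons => /andP[/eqP].
have ew2 y : y \in q :: b -> e w y = (y == q) by move/aw/eqP.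
apply/ipath_cat; split.
- rewrite -(eq_ipath (e := e)) // => x y xs ys; symmetry; apply: lc_id.
  by move=> /(ew1 _ xs)-> /(ew1 _ ys)->.
- rewrite -(eq_ipath (e := e)) // => x y xs ys; symmetry; apply: lc_id.
  by rewrite !ew2 // => /eqP-> /eqP->.
- move=> x y xs ys; have [xy exy] := c x y xs (mem_behead (ys : y \in behead (w :: q :: b))).
  split=> //; rewrite lcE // exy (ew2 y) //= [w == y]eq_sym.
  rewrite (_ : (y == w) = false) ?andbF ?addbF; last first.
    by apply: contraNF wqb => /eqP<-.
  have [_] := c _ _ xs (mem_head _ _); rewrite gsym => -> /=.
  by rewrite !last_rcons eqxx andbT [q == y]eq_sym.
Qed.

Definition hole e x t := [/\ ipath e t, x \notin t &
  {in t, forall y, e x y = (y == head x t) || (y == last x t)}].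

Hypothesis n_gt2 : 2 < n.

(** The last vertex [z] of the path has two neighbours on the hole; complementing at [z] joins them,
    which leaves a hole with one vertex less, until exactly [n] vertices remain. *)
Lemma hole_has_cycle e x t : hole e x t -> n <= (size t).+1 -> has_cycle e.
Proof.
move: {2}(size t) (leqnn (size t)) => m.
elim: m e t => [|m IH] e t; first by case: t => // _ _ /= ?; exfalso; lia.
move=> tm [p xt ext]; rewrite leq_eqVlt => /orP[/eqP sn|sn].
  exists [::], (fun i => nth x (x :: t) i).
    move=> i j /eqP; rewrite nth_uniq //= ?xt ?(ipath_uniq p) //= -?sn //.
    by move/eqP/val_inj.
  have main (i j : 'I_n) : i < j ->
      e (nth x (x :: t) i) (nth x (x :: t) j) = cycle_adj i j.
    case: i j => [i ni] [[//|j] nj] /= ij.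
    have jt : j < size t by lia.
    rewrite /cycle_adj -!val_eqE /= (modn_small (leq_ltn_trans ij nj)).
    rewrite neq_ltn ij /= eqSS.
    (* The wrap-around edge: it occurs only between index 0 and the last index. *)
    have -> : (i == j.+2 %% n) = (i == 0) && (j.+2 == n).
      have [nj2|nj2] := eqVneq j.+2 n; first by rewrite nj2 modnn andbT.
      by rewrite modn_small ?andbF; [apply/eqP; lia|lia].
    case: i ni ij => [|i] ni ij /=.
      rewrite ext ?mem_nth // -nth0 -nth_last !(nth_uniq _ _ _ (ipath_uniq p)) //; try lia.
      by congr (_ || _); rewrite sn eqSS; case: (size t) jt.
      by case: (size t) jt.
    by rewrite (ipath_nth _ p) ?orbF.
  move=> i j /=; have [ij|ij|/val_inj->] := ltngtP i j.
  - exact: main.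
  - by rewrite gsym main // cycle_sym.
  - by rewrite girr cycle_irrefl.
case: (lastP t) tm p xt ext sn => [|{}t z]; first by rewrite /=; lia.
case: (lastP t) => [|{}t p]; first by rewrite /=; lia.
case: t => [|h t]; first by rewrite /=; lia.
move: (h :: t) (isT : 0 < size (h :: t)) => {h}t; rewrite !size_rcons => t0 tm q xt ext sn.
apply: (@has_cycle_lc _ z); apply: (IH _ (rcons t p)); rewrite ?size_rcons; [lia| |lia].
move: q; rewrite -cats1 => /ipath_cat[q _ c].
have xz : x != z.
  by apply: contraNneq xt => ->; rewrite mem_rcons mem_head.
have ezn y : y \in rcons t p -> y != z.
  by move=> yt; have [yz] := c _ _ yt (mem_head _ _).
have ez y : y \in rcons t p -> e z y = (y == p).
  move=> yt; have [_] := c _ _ yt (mem_head _ _).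
  by rewrite gsym last_rcons /= eqxx andbT [p == y]eq_sym.
have ex y : y \in rcons t p -> e x y = (y == head x (rcons t p)).
  move=> yt; rewrite ext; last by rewrite -cats1 mem_cat yt.
  rewrite last_rcons (negbTE (ezn _ yt)) orbF.
  by case: (t) t0.
split.
- rewrite -(eq_ipath (e := e)) // => a b ta tb; symmetry; apply: lc_id.
  by rewrite !ez // => /eqP-> /eqP->.
- by apply: contra xt => xt; rewrite -cats1 mem_cat xt.
- move=> y yt; rewrite lcE; last first.
    by apply: contraNneq xt => ->; rewrite -cats1 mem_cat yt.
  rewrite [e z x]gsym ext ?mem_rcons ?mem_head // last_rcons eqxx orbT /=.
  rewrite ez // ex // last_rcons.
  case: eqP => [->|_]; last by rewrite orbF.
  rewrite orbT; case: (t) t0 q => // h s _ /ipath_uniq /=.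
  by rewrite mem_rcons inE negb_or => /andP[/andP[/negbTE]]; rewrite eq_sym => ->.
Qed.

(** [z] is a stretch of non-neighbours of [u] behind the neighbour [x]; at length [n] it closes a
    hole through [u]. Before that, one complements at the vertex [w] after the next neighbour [y].
    If [u] sees [w], then [y] ceases to be a neighbour and joins the stretch; otherwise the path
    shrinks and [u] keeps its neighbours. Growing the stretch costs at most the three neighbours
    [y], [w] and [q], hence the factor 3. *)
Lemma fan_gap e u x z r : ipath e (x :: z ++ r) -> u \notin (x :: z ++ r) ->
  e u x -> {in z, forall y, ~~ e u y} ->
  3 * (n - size z) < count (e u) r -> has_cycle e.
Proof.
move: {2}(size r) (leqnn (size r)) => m.
elim: m e z r => [|m IH] e z [|y r] //= rm p uxzr ux uz.
have [uy|uy] := boolP (e u y); last first.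
  rewrite add0n => c; apply: (IH _ (rcons z y) r); rewrite ?cat_rcons //.
    by move=> w; rewrite mem_rcons inE => /orP[/eqP->|/uz].
  by rewrite size_rcons; lia.
have [nz|nz] := leqP n (size z).
  move=> _; apply: (@hole_has_cycle _ u (x :: rcons z y)); last first.
    by rewrite /= size_rcons; lia.
  have p' : ipath e ((x :: rcons z y) ++ r) by rewrite cat_cons cat_rcons.
  have uxz : u \notin x :: rcons z y.
    by move: uxzr; rewrite -cat_rcons -cat_cons mem_cat negb_or => /andP[].
  split=> //; first exact: ipath_catl p'.
  move=> w; rewrite inE => /orP[/eqP->|]; first by rewrite ux eqxx.
  rewrite /= last_rcons mem_rcons inE => /orP[/eqP->|wz].
    by rewrite eqxx uy orbT.
  rewrite (negbTE (uz _ wz)); symmetry; apply/negbTE; rewrite negb_or.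
  move: (ipath_uniq p'); rewrite /= mem_cat mem_rcons inE !negb_or cat_uniq rcons_uniq.
  case/andP=> /andP[/andP[_ xz] _] /andP[/andP[yz _] _].
  by apply/andP; split; [apply: contraNneq xz => <-|apply: contraNneq yz => <-].
case: r rm p uxzr => [|w [|q r]] //= rm p uxzr c; try lia.
have p' := ipath_contract (a := x :: z) p.
have /and5P[uz' uNy uNw uNq ur] : [&& u \notin z, u != y, u != w, u != q & u \notin r].
  by move: uxzr; rewrite !(in_cons, mem_cat) !negb_or => /andP[].
have uNx := adj_neq ux.
move: p; rewrite -!(cat_rcons y) -cat_cons => /ipath_cat[_ /and3P[wr /allP aw _] cr].
have ew s : s \in q :: r -> e w s = (s == q) by move/aw/eqP.
have ew1 s : s \in x :: rcons z y -> e w s = (s == y).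
  move=> sz; have [_] := cr _ _ sz (mem_head _ _).
  by rewrite gsym /= eqxx andbT last_rcons [y == s]eq_sym.
have [xz yz] : x != y /\ y \notin z.
  move: (ipath_uniq p'); rewrite /= !(mem_cat, in_cons) !negb_or cat_uniq /=.
  by rewrite negb_or => /andP[/and4P[_ -> _ _]] /and3P[_ /andP[-> _] _].
apply: (@has_cycle_lc _ w).
have lcu s : s \in x :: z -> lc e w u s = e u s.
  move=> sz; apply: lc_id; rewrite (ew1 s).
    by move=> _ /eqP sy; move: sz; rewrite sy inE eq_sym (negbTE xz) (negbTE yz).
  by move: sz; rewrite !inE mem_rcons inE => /orP[->|->]; rewrite ?orbT.
have lcr s : s \in r -> lc e w u s = e u s.
  move=> sr; apply: lc_id; rewrite (ew s) ?inE ?sr ?orbT //.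
  move=> _ /eqP sq; move: (ipath_uniq p'); rewrite /= -sq => /andP[_].
  by rewrite cat_uniq /= sr !andbF.
have wy : e w y by rewrite ew1 // inE mem_rcons mem_head orbT.
have wq : e w q by rewrite ew // mem_head.
have [uw|uw] := boolP (e u w).
  apply: (IH (lc e w) (rcons z y) (q :: r)).
  - by rewrite -ltnS; apply: leq_trans rm.
  - by rewrite cat_rcons.
  - rewrite cat_rcons; by rewrite !(in_cons, mem_cat) !negb_or uNx uz' uNy uNq.
  - by rewrite lcu ?mem_head.
  - move=> s; rewrite mem_rcons inE => /orP[/eqP->|sz].
      by rewrite lc_flip ?uy // gsym.
    by rewrite lcu ?uz // inE sz orbT.
  - rewrite size_rcons /= (eq_in_count lcr) lc_flip // 1?gsym //; move: c; rewrite uw.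
    by move: (size z) nz (count _ _) => k nk c; clear -nk; case: (e u q) => /=; lia.
have lcw s : lc e w u s = e u s by apply: lc_id; rewrite gsym (negbTE uw).
apply: (IH (lc e w) z (y :: q :: r)) => //.
- by rewrite !(in_cons, mem_cat) !negb_or uNx uz' uNy uNq.
- by rewrite lcw.
- by move=> s /uz; rewrite lcw.
- by rewrite /= !lcw (eq_count lcw); move: c; rewrite (negbTE uw) uy.
Qed.

Lemma fan e u s : ipath e s -> u \notin s -> (3 * n).+1 < count (e u) s ->
  has_cycle e.
Proof.
move=> p us c; have /(has_nthP u)[i si ui] : has (e u) s by rewrite has_count; lia.
have := cat_take_drop (find (e u) s) s.
have hs : has (e u) s by rewrite has_count; lia.
have fs : find (e u) s < size s by rewrite -has_find.
rewrite (drop_nth u fs) => sE.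
move: p us c; rewrite -sE => /ipath_catr p.
rewrite mem_cat negb_or => /andP[_ us]; rewrite count_cat /= (nth_find u hs).
have -> : count (e u) (take (find (e u) s) s) = 0.
  apply/eqP; rewrite -leqn0 leqNgt -has_count; apply/negP=> /(has_nthP u)[j].
  rewrite size_take fs => jf; rewrite nth_take //.
  by rewrite (before_find u jf).
move=> c; apply: (fan_gap (z := [::]) p us (nth_find u hs)) => //=; lia.
Qed.

(** Consecutive neighbours of [u] have fewer than [n] vertices between them, or a hole appears, and
    [fan] caps their number; the product is the width of the window. *)
Lemma window e u x r : ~ has_cycle e -> ipath e (x :: r) -> u \notin x :: r -> e u x ->
  {in r, forall y, e u y -> index y r < n * (3 * n).+1}.
Proof.
move=> noC p ur ux.
have c : count (e u) r <= (3 * n).+1.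
  rewrite leqNgt; apply/negP=> c; apply: noC; apply: (fan p ur).
  by rewrite /= ux; lia.
move=> y yr uy; apply: (@leq_trans (n * count (e u) r)); last by rewrite leq_mul2l c orbT.
move: {c} x p ur ux yr; move: {2}(size r) (leqnn (size r)) => m.
elim: m r => [|m IH] r rm x p ur ux yr; first by case: r rm yr {p ur}.
have hs : has (e u) r by apply/hasP; exists y.
have fs : find (e u) r < size r by rewrite -has_find.
have := cat_take_drop (find (e u) r) r; rewrite (drop_nth u fs).
move: (nth_find u hs); set w := nth _ _ _; set z := take _ _; set r' := drop _ _ => uw rE.
have uz : {in z, forall y, ~~ e u y}.
  move=> s /(nthP u)[j]; rewrite size_take fs => jf <-; rewrite nth_take //.
  by rewrite (before_find u jf).
have zn : size z < n.
  rewrite ltnNge; apply/negP=> zn; apply: noC.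
  apply: (@hole_has_cycle _ u (x :: rcons z w)); last by rewrite /= size_rcons; lia.
  have p' : ipath e ((x :: rcons z w) ++ r') by rewrite cat_cons cat_rcons rE.
  have pz := ipath_catl p'.
  split=> //.
    by move: ur; rewrite -rE -cat_rcons -cat_cons mem_cat negb_or => /andP[].
  move=> s; rewrite inE => /orP[/eqP->|]; first by rewrite ux eqxx.
  rewrite /= last_rcons mem_rcons inE => /orP[/eqP->|sz]; first by rewrite eqxx uw orbT.
  rewrite (negbTE (uz _ sz)); symmetry; apply/negbTE; rewrite negb_or.
  move: (ipath_uniq pz); rewrite /= mem_rcons inE negb_or rcons_uniq.
  case/andP=> /andP[_ xz] /andP[wz _].
  by apply/andP; split; [apply: contraNneq xz => <-|apply: contraNneq wz => <-].
have yz : y \notin z by apply/negP=> /uz; rewrite uy.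
have cz : count (e u) z = 0.
  by apply/eqP; rewrite -leqn0 leqNgt -has_count; apply/hasPn.
move: yr p ur rm; rewrite -rE count_cat cz /= uw index_cat (negbTE yz) /=.
rewrite mem_cat (negbTE yz) inE /= [w == y]eq_sym.
have [_ _ _ _ _|yw /= yr p ur] := eqVneq y w; first by rewrite mulnDr; lia.
rewrite size_cat /= => rm.
suff : index y r' < n * count (e u) r' by rewrite mulnDr; lia.
apply: (IH _ _ w) => //; first lia.
- by move: p; rewrite -cat_cons => /ipath_catr.
- by move: ur; rewrite -cat_cons mem_cat negb_or => /andP[].
Qed.

Lemma ipath_rcons e s y : ipath e s -> y \notin s ->
  {in s, forall x, e x y = (x == last y s)} -> ipath e (rcons s y).
Proof.
move=> p ys exy; rewrite -cats1; apply/ipath_cat; split=> // x z xs.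
rewrite inE => /eqP->; rewrite exy //= eqxx andbT; split; last exact: eq_sym.
by apply: contraNneq ys => <-.
Qed.

Lemma ipath_rconsP e s y : ipath e (rcons s y) -> [/\ ipath e s, y \notin s &
  {in s, forall x, e x y = (x == last y s)}].
Proof.
move=> p; move: (ipath_uniq p); rewrite rcons_uniq => /andP[ys _].
move: p; rewrite -cats1 => /ipath_cat[p _ c]; split=> // x xs.
by have [_ ->] := c x y xs (mem_head _ _); rewrite eqxx andbT eq_sym.
Qed.

Lemma ipath_rev e s : ipath e (rev s) = ipath e s.
Proof.
have main t : ipath e t -> ipath e (rev t).
  elim: t => // x t IH /and3P[xt /allP a p]; rewrite rev_cons.
  apply: ipath_rcons; rewrite ?mem_rev ?IH // => y; rewrite mem_rev => yt.
  by rewrite gsym (eqP (a y yt)); case: (t) yt => // z t' _; rewrite rev_cons last_rcons.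
by apply/idP/idP=> /main //; rewrite revK.
Qed.

Lemma ipath_consP e x s : ipath e s -> x \notin s ->
  {in s, forall y, e x y = (y == head x s)} -> ipath e (x :: s).
Proof. by move=> p xs a; apply/and3P; split=> //; apply/allP=> y /a->. Qed.

Lemma split_first (a : pred T) s : has a s -> exists s1 q s2,
  [/\ s = s1 ++ q :: s2, a q & {in s1, forall z, ~~ a z}].
Proof.
elim: s => //= x s IH; case ax: (a x) => /=; first by exists [::], x, s.
case/IH=> s1 [q [s2 [-> aq s1a]]]; exists (x :: s1), q, s2; split=> //.
by move=> z; rewrite inE => /orP[/eqP->|/s1a//]; rewrite ax.
Qed.

Lemma split_last (a : pred T) s : has a s -> exists s1 q s2,
  [/\ s = s1 ++ q :: s2, a q & {in s2, forall z, ~~ a z}].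
Proof.
rewrite -has_rev => /split_first[s1 [q [s2 [sE aq s1a]]]].
exists (rev s2), q, (rev s1); split=> // [|z].
  by rewrite -[s]revK sE rev_cat rev_cons cat_rcons.
by rewrite mem_rev => /s1a.
Qed.

(* Two vertices y, y' adjacent to v whose neighbourhoods on the path lie in
   disjoint windows close up a long hole, through v or directly. *)
Lemma second_layer_path e v s : ~ has_cycle e -> ipath e s ->
  {in s, forall p, [/\ p != v, ~~ e v p & exists2 y, e v y & e y p]} ->
  size s <= 2 * (n * (3 * n).+1) + n + 1.
Proof.
have [w wE] : {w | w = n * (3 * n).+1} by exists (n * (3 * n).+1).
rewrite -wE => noC ps sP; rewrite leqNgt; apply/negP=> sl.
have win u x r y : ipath e (x :: r) -> u \notin x :: r -> e u x -> y \in r ->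
    e u y -> index y r < w.
  by rewrite wE => p ur ux yr; apply: (window noC p ur ux).
case: s ps sP sl => [|p0 r] ps sP sl; first by move: sl; rewrite /=; lia.
have parentN y p : e v y -> p \in p0 :: r -> y != p.
  by move=> vy /sP[_ vp _]; apply: contraNneq vp => <-.
have [_ _ [y vy yp0]] := sP _ (mem_head _ _).
have yr : y \notin p0 :: r by apply/negP=> /(parentN _ _ vy); rewrite eqxx.
(* [q] is the last neighbour of [y]. By [window] it is near the start, so a long part [s2] is unseen
   by [y]. *)
have [s1 [q [s2 [sE yq ys2]]]] : exists s1 q s2,
    [/\ p0 :: r = s1 ++ q :: s2, e y q & {in s2, forall z, ~~ e y z}].
  by apply: split_last; rewrite /= yp0.
have s1w : size s1 <= w.
  move: sE; case: (s1) => [//|_ s1'] [<- rE].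
  have := win _ _ _ q ps yr yp0; rewrite rE mem_cat mem_head orbT.
  move/(_ isT yq); rewrite index_cat /= eqxx addn0 ifN //.
  move: (ipath_uniq ps); rewrite /= rE cat_uniq /= negb_or.
  by case/andP=> _ /and3P[_ /andP[]].
have s2l : w + n < size s2.
  have rs : size (p0 :: r) = size s1 + (size s2).+1 by rewrite sE size_cat.
  by move: sl; rewrite rs; clear -s1w; lia.
(* A parent [y'] of [p] cannot see [q], which is too far away for one window; and its first
   neighbour in [s2] is within a window of [p], hence at least [n] vertices separate it from [q]. *)
set p := nth p0 s2 (w + n); have ps2 : p \in s2 by rewrite mem_nth.
have pqs : ipath e (q :: s2) by move: ps; rewrite sE => /ipath_catr.
have us2 : uniq s2 by move: (ipath_uniq pqs) => /andP[].
have ip : index p s2 = w + n by rewrite index_uniq.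
have sub z : z \in q :: s2 -> z \in p0 :: r by rewrite sE mem_cat orbC => ->.
have [_ _ [y' vy' y'p]] := sP p (sub _ (mem_behead (ps2 : p \in behead (q :: s2)))).
have y'r : y' \notin q :: s2.
  by apply/negP=> /sub /(parentN _ _ vy'); rewrite eqxx.
have y'q : ~~ e y' q.
  apply/negP=> y'q; have := win _ _ _ _ pqs y'r y'q ps2 y'p.
  by rewrite ip; lia.
have yy' : y != y' by apply: contraNneq y'q => <-.
have [|z [q' [s3 [s2E y'q' zy']]]] := @split_first (e y') s2.
  by apply/hasP; exists p.
have q'z : q' \notin z.
  by apply: contraL y'q' => /zy'.
have zn : n <= size z.
  have pz : p \notin z by apply/negP=> /zy'; rewrite y'p.
  move: ip; rewrite s2E index_cat (negbTE pz) /=.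
  have [_|q'p ip] := eqVneq q' p; first by rewrite addn0 => ->; apply: leq_addl.
  have p3 : p \in s3.
    by move: ps2; rewrite s2E mem_cat (negbTE pz) inE eq_sym (negbTE q'p).
  suff iw: index p s3 < w by rewrite -(leq_add2r w) [n + w]addnC -ip leq_add2l.
  apply: (win _ _ _ _ _ _ y'q' p3 y'p); first by move: pqs; rewrite s2E -cat_cons => /ipath_catr.
  by move: y'r; rewrite s2E -cat_cons mem_cat negb_or => /andP[].
set t := q :: rcons z q'.
have pt : ipath e t.
  by move: pqs; rewrite s2E -cat_rcons -cat_cons => /ipath_catl.
have subt x : x \in t -> x \in p0 :: r.
  by move=> xt; apply: sub; rewrite s2E -cat_rcons -cat_cons mem_cat xt.
have zs2 x : x \in rcons z q' -> x \in s2.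
  by move=> xz; rewrite s2E -cat_rcons mem_cat xz.
have y't : y' \notin t by apply/negP=> /subt /(parentN _ _ vy'); rewrite eqxx.
have yt : y \notin t by apply/negP=> /subt /(parentN _ _ vy); rewrite eqxx.
have pt' : ipath e (rcons t y').
  apply: ipath_rcons => // x; rewrite gsym inE /= last_rcons => /orP[/eqP->|].
    rewrite (negbTE y'q); symmetry; apply/negbTE.
    move: (ipath_uniq pt) => /andP[qz _]; apply: contraNneq qz => ->.
    by rewrite mem_rcons mem_head.
  rewrite mem_rcons inE => /orP[/eqP->|xz]; first by rewrite y'q' eqxx.
  by rewrite (negbTE (zy' _ xz)); symmetry; apply: contraNF q'z => /eqP<-.
have eyt : {in t, forall x, e y x = (x == q)}.
  move=> x; rewrite inE => /orP[/eqP->|xz]; first by rewrite yq eqxx.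
  rewrite (negbTE (ys2 _ (zs2 _ xz))); symmetry; apply/negbTE.
  by move: (ipath_uniq pt) => /andP[qz _]; apply: contraNneq qz => <-.
have [eyy'|eyy'] := boolP (e y y').
  apply: noC; apply: (@hole_has_cycle _ y (rcons t y')); last first.
    by rewrite size_rcons /= size_rcons; do 4!apply: leqW.
  split=> //; first by rewrite mem_rcons inE negb_or yy'.
  move=> x; rewrite mem_rcons last_rcons inE => /orP[/eqP->|xt] /=.
    by rewrite eyy' eqxx orbT.
  rewrite eyt // (_ : (x == y') = false) ?orbF //.
  by apply: contraNF y't => /eqP<-.
apply: noC; apply: (@hole_has_cycle _ v (y :: rcons t y')); last first.
  by rewrite /= !size_rcons; do 5!apply: leqW.
split.
- apply: ipath_consP => //; first by rewrite mem_rcons inE negb_or yy'.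
  move=> x; rewrite mem_rcons inE => /orP[/eqP->|xt] /=; last exact: eyt.
  by rewrite (negbTE eyy'); symmetry; apply: contraNF y't => /eqP->; rewrite mem_head.
- rewrite in_cons mem_rcons in_cons 2!negb_or (adj_neq vy) (adj_neq vy') andTb.
  by apply/negP=> /subt /sP[]; rewrite eqxx.
- move=> x; rewrite last_cons last_rcons [head _ _]/= in_cons mem_rcons in_cons => /or3P[/eqP->|/eqP->|xt].
  + by rewrite vy eqxx.
  + by rewrite vy' eqxx orbT.
  + have [_ /negbTE-> _] := sP _ (subt _ xt); symmetry; apply/negbTE.
    rewrite negb_or; apply/andP.
    by split; [apply: contraNneq yt => <-|apply: contraNneq y't => <-].
Qed.

End LocalComplementation.
Arguments ipath : simpl never.

(** * Connectedness and the Gyarfas path *)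

Section Connected.
Variables (T : finType).
Implicit Types (e : graph T) (A C D S Z : {set T}) (x y z : T).

Definition connected e S := forall A, A \subset S -> A != set0 -> A != S ->
  exists2 x, x \in A & exists2 y, y \in S :\: A & e x y.

Definition closed_in e Z C := C \subset Z /\
  {in C & Z :\: C, forall x y, ~~ e x y}.

Lemma closed_in_trans e Z C A : closed_in e Z C -> closed_in e C A -> closed_in e Z A.
Proof.
move=> [CZ nC] [AsC nA]; split; first exact: subset_trans AsC CZ.
move=> x y xA; rewrite inE => /andP[yA yZ].
have [yC|yC] := boolP (y \in C); first by apply: nA; rewrite // inE yA.
by apply: nC; rewrite ?inE ?yC // (subsetP AsC).
Qed.

Lemma closed_inD e Z A : closed_in e Z A -> closed_in e Z (Z :\: A).
Proof.
case=> AZ nA; split; first exact: subsetDl.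
move=> x y; rewrite inE => /andP[xA xZ]; rewrite !inE negb_and negbK.
case/andP=> /orP[yA yZ|/negbTE->//]; rewrite gsym; apply: nA => //.
by rewrite inE xA.
Qed.

(* A closed set minimal among those satisfying [P] is connected as soon as
   [P] passes to one of the two parts of any disconnection. *)
Lemma closed_connected e Z (P : {set T} -> bool) : P Z ->
  (forall C A, closed_in e Z C -> P C -> closed_in e C A -> P A || P (C :\: A)) ->
  exists C, [/\ closed_in e Z C, connected e C & P C].
Proof.
move=> PZ split_P.
have [m] := ubnP #|Z|; elim: m Z PZ split_P => // m IH Z PZ split_P Zm.
have Zcl : closed_in e Z Z by split=> // x y; rewrite setDv inE.
pose dis (A : {set T}) := [&& A \subset Z, A != set0, A != Z &
  [forall x in A, forall y in Z :\: A, ~~ e x y]].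
have [/existsP[A /and4P[AZ A0 AnZ nA]]|conn] := boolP [exists A, dis A].
  have Acl : closed_in e Z A by split=> // x y xA yA; move/forall_inP: nA => /(_ x xA)/forall_inP; apply.
  have [C [Ccl PC Cm]] : exists C, [/\ closed_in e Z C, P C & #|C| < #|Z|].
    case/orP: (split_P _ _ Zcl PZ Acl) => PA; [exists A | exists (Z :\: A)].
      by split=> //; apply: proper_card; rewrite properEneq AnZ.
    split=> //; first exact: closed_inD.
    apply: proper_card; rewrite properEneq subsetDl andbT.
    case/set0Pn: A0 => x xA; apply: contraTneq (subsetP AZ x xA) => <-.
    by rewrite inE xA.
  have [||D [Dcl cD PD]] := IH C PC; [|by apply: leq_trans Cm _|].
    move=> D A' Dcl; apply: split_P; exact: closed_in_trans Dcl.
  by exists D; split=> //; apply: closed_in_trans Dcl.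
exists Z; split=> // A AZ A0 AnZ; move: conn; rewrite negb_exists => /forallP/(_ A).
rewrite /dis AZ A0 AnZ /= => /forall_inPn[x xA /forall_inPn[y yZ]].
by rewrite negbK => xy; exists x => //; exists y.
Qed.

Definition nbr e x := [set y | e x y].

(** Some edge of [C] leaves [C']; as [C'] is closed once the neighbours of [x] are removed, the
    outer end of this edge is such a neighbour. *)
Lemma connected_step e C x C' : connected e C -> (exists2 a, a \in C & e x a) ->
  closed_in e (C :\: nbr e x) C' -> C' != set0 ->
  exists2 x1, x1 \in C & e x x1 /\ exists2 d, d \in C' & e x1 d.
Proof.
move=> cC [a aC xa] [sC' nC'] C'0.
have sC : C' \subset C by apply: subset_trans sC' (subsetDl _ _).
have C'C : C' != C.
  by apply: contraTneq aC => <-; apply: contraL xa => /(subsetP sC'); rewrite !inE => /andP[].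
have [d dC' [x1]] := cC _ sC C'0 C'C; rewrite inE => /andP[x1C' x1C] dx1.
exists x1 => //; split; last by exists d => //; rewrite gsym.
by apply/negPn; apply: contraL dx1 => xx1; apply: nC'; rewrite // !inE x1C' xx1.
Qed.

Lemma component_of e Z b : b \in Z ->
  exists C, [/\ closed_in e Z C, connected e C & b \in C].
Proof.
move=> bZ; apply: (closed_connected (P := fun C => b \in C)) => // C A _ bC _.
by rewrite inE bC andbT; case: (b \in A).
Qed.

(** The path goes from [x] to a neighbour [x1] that touches the component of [S :\: nbr e x]
    containing a neighbour of [y], and continues inside this component, out of sight of [x]; so no
    chord at [x] arises. *)
Lemma connected_path e S x y : connected e S -> x \notin S -> y \notin S -> x != y ->
  (exists2 a, a \in S & e x a) -> (exists2 b, b \in S & e y b) ->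
  exists2 q : seq T, {subset q <= S} & ipath e (x :: rcons q y).
Proof.
have [m] := ubnP #|S|; elim: m S x => // m IH S x Sm cS xS yS xy [a aS xa] [b bS yb].
have ipath2 u w : e u w -> ipath e [:: u; w].
  by move=> uw; rewrite !ipath_cons /= inE (adj_neq uw) uw eqxx.
have [exy|exy] := boolP (e x y); first by exists [::] => //; apply: ipath2.
have [xb|xb] := boolP (e x b).
  exists [:: b]; first by move=> z; rewrite inE => /eqP->.
  rewrite /= ipath_cons ipath2 1?gsym // !inE negb_or xy (adj_neq xb) /=.
  by rewrite xb !eqxx (negbTE exy) eq_sym (negbTE (adj_neq yb)).
have bD : b \in S :\: nbr e x by rewrite !inE xb.
have [C [Ccl cC bC]] := component_of e bD.
have [||x1 x1S [xx1 [d dC x1d]]] := @connected_step e S x C cS _ Ccl; first by exists a.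
  by apply/set0Pn; exists b.
have CS z : z \in C -> z \in S /\ ~~ e x z.
  by case: Ccl => /subsetP sC _ /sC; rewrite !inE => /andP[].
have x1C : x1 \notin C by apply/negP=> /CS[_]; rewrite xx1.
have [|||||q qC p] := IH C x1 _ cC x1C.
- rewrite -ltnS; apply: leq_trans Sm; rewrite ltnS; apply: proper_card.
  by apply/properP; split; [apply/subsetP=> z /CS[]|exists x1].
- by apply: contra yS => /CS[].
- by apply: contraNneq yS => <-.
- by exists d.
- by exists b.
exists (x1 :: q) => [z|]; first by rewrite inE => /orP[/eqP->|/qC/CS[]].
apply: ipath_consP => // [|z].
  rewrite inE mem_rcons inE !negb_or xy (adj_neq xx1) /=.
  by apply: contra xS => /qC/CS[].
rewrite inE mem_rcons inE => /or3P[/eqP->|/eqP->|zq] /=; first by rewrite xx1 eqxx.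
  by rewrite (negbTE exy); symmetry; apply: contraNF yS => /eqP->.
have [zS /negbTE->] := CS _ (qC _ zq); symmetry; apply: contraNF x1C => /eqP<-.
exact: qC.
Qed.

(* Gyarfas' path argument, for an arbitrary set function [mu] of which no
   neighbourhood captures more than [r] and which, up to a loss of [theta],
   is carried by a single component. *)
Lemma gyarfas e (U : {set T}) (mu : {set T} -> nat) r theta t0 :
  {in U, forall x C, C \subset U -> mu C <= mu (C :\: nbr e x) + r} ->
  (forall Z, Z \subset U -> t0 <= mu Z -> exists C,
     [/\ closed_in e Z C, connected e C, C != set0 & mu Z <= mu C + theta]) ->
  forall j x C, x \in U -> C \subset U -> x \notin C -> connected e C ->
    (exists2 a, a \in C & e x a) -> j * (r + theta) + t0 <= mu C ->
  exists s D, [/\ size s = j, {subset s <= C}, ipath e (x :: s) &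
    [/\ D \subset C, connected e D, mu C <= mu D + j * (r + theta),
        exists2 d, d \in D & e (last x s) d &
        {in x :: s, forall y, y \notin D /\ (y != last x s -> {in D, forall d, ~~ e y d})}]].
Proof.
move=> drop comp; elim=> [|j IH] x C xU CU xC cC xa muC.
  exists [::], C; split=> //; split=> //; first by rewrite addn0.
  by move=> y; rewrite inE /= => /eqP->; rewrite eqxx.
have ZU : C :\: nbr e x \subset U by apply: subset_trans (subsetDl _ _) CU.
have [|C' [C'cl cC' C'0 muC']] := comp _ ZU.
  have := drop _ xU _ CU; rewrite mulSn in muC; lia.
have [x1 x1C [xx1 x1d]] := connected_step cC xa C'cl C'0.
have C'C z : z \in C' -> z \in C /\ ~~ e x z.
  by case: C'cl => /subsetP sC _ /sC; rewrite !inE => /andP[].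
have sC'C : C' \subset C by apply/subsetP=> z /C'C[].
have := drop _ xU _ CU => dropC; rewrite mulSn in muC.
have [||||s [D [ss sC p [DC cD muD lD sD]]]] := IH x1 C' _ _ _ cC' x1d.
- exact: (subsetP CU).
- exact: subset_trans sC'C CU.
- by apply/negP=> /C'C[_]; rewrite xx1.
- by lia.
exists (x1 :: s), D; split.
- by rewrite /= ss.
- by move=> z; rewrite inE => /orP[/eqP->//|/sC/C'C[]].
- apply: ipath_consP => // [|z].
    rewrite inE negb_or (adj_neq xx1); apply: contra xC => /sC/C'C[] //.
  rewrite inE /= => /orP[/eqP->|zs]; first by rewrite xx1 eqxx.
  have [_ /negbTE->] := C'C _ (sC _ zs); symmetry; apply/negbTE.
  by move: (ipath_uniq p) => /andP[x1s _]; apply: contraNneq x1s => <-.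
- split=> //; [exact: subset_trans DC sC'C | by rewrite mulSn; lia |].
  move=> y; rewrite inE => /orP[/eqP->|ys]; last exact: sD.
  split; first by apply: contra xC => /(subsetP DC)/C'C[].
  by move=> _ d /(subsetP DC)/C'C[].
Qed.
(** [gyarfas] starts from a vertex outside its connected set. Such a vertex is made by deleting one
    from a component and passing to a component again; two passes and one deletion cost
    [(2 * theta).+1]. *)
Lemma gyarfas_path e (U : {set T}) (mu : {set T} -> nat) r theta t0 j :
  {in U, forall x C, C \subset U -> mu C <= mu (C :\: nbr e x) + r} ->
  (forall Z, Z \subset U -> t0 <= mu Z -> exists C,
     [/\ closed_in e Z C, connected e C, C != set0 & mu Z <= mu C + theta]) ->
  (forall C x, mu C <= (mu (C :\ x)).+1) ->
  j * (r + theta) + t0 + (2 * theta).+1 <= mu U ->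
  exists s, [/\ size s = j.+1, {subset s <= U} & ipath e s].
Proof.
move=> drop comp mu1 muU.
have [||C [Ccl cC C0 UC]] := comp U; first exact: subxx.
  by apply: leq_trans muU; rewrite addnAC leq_addl.
have CU : C \subset U by case: Ccl.
have [x xC] := set0Pn _ C0.
have Cx : j * (r + theta) + t0 + theta <= mu (C :\ x).
  rewrite -ltnS; apply: leq_trans (mu1 C x); rewrite -(leq_add2r theta).
  by apply: leq_trans UC; apply: leq_trans muU; rewrite addSnnS -addnA leq_add2l mul2n -addnn addnS.
have CxU : C :\ x \subset U by apply: subset_trans CU; apply: subsetDl.
have [|C' [C'cl cC' C'0 CC']] := comp _ CxU.
  by apply: leq_trans Cx; rewrite addnAC leq_addl.
have C'C : C' \subset C by case: C'cl => s _; apply: subset_trans s (subsetDl _ _).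
have xC' : x \notin C'.
  by case: C'cl => /subsetP s _; apply/negP=> /s; rewrite !inE eqxx.
have xnb : exists2 a, a \in C' & e x a.
  have [|a aC' [b]] := cC C' C'C C'0; first by apply: contraNneq xC' => ->.
  rewrite inE => /andP[bC' bC] ab; exists a => //; rewrite gsym.
  have [<-//|bx] := eqVneq b x.
  by case: C'cl => _ /(_ a b aC'); rewrite !inE bC' bx bC ab => /(_ isT).
have [|||s [D [ss sC p _]]] := gyarfas drop comp _ _ xC' cC' xnb (j := j).
- exact: (subsetP CU).
- exact: subset_trans C'C CU.
- by rewrite -(leq_add2r theta); apply: leq_trans CC'.
exists (x :: s); split=> [|y|//]; first by rewrite /= ss.
rewrite inE => /orP[/eqP->|/sC /(subsetP C'C)]; exact: (subsetP CU).
Qed.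
End Connected.

(** * Chromatic number of vertex sets *)

Section Chi.
Variables (T : finType) (e : graph T).
Implicit Types (A B C S Z : {set T}) (x y z : T) (f : T -> nat).

Definition proper S f := {in S &, forall x y, e x y -> f x != f y}.

(** The palette is bounded only to make colourability decidable: for larger [k] the ranks of the
    vertices give a colouring. *)
Definition col S k := [exists c : {ffun T -> 'I_#|T|.+1},
  [forall x in S, (c x < k) && [forall y in S, e x y ==> (c x != c y)]]].

Lemma colP S k :
  reflect (exists2 f, {in S, forall x, f x < k} & proper S f) (col S k).
Proof.
apply: (iffP existsP) => [[c /forall_inP cP]|[f fk fP]].
  exists (fun x => c x : nat) => [x /cP/andP[]//|x y /cP/andP[_ /forall_inP cx] yS xy].
  by have := cx y yS; rewrite xy.
have [kT|kT] := leqP k #|T|.+1.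
  exists [ffun x => inord (f x)]; apply/forall_inP=> x xS.
  have fT y : y \in S -> (inord (f y) : 'I_#|T|.+1) = f y :> nat.
    by move=> yS; rewrite inordK // (leq_trans (fk y yS)).
  rewrite ffunE fT // fk //=; apply/forall_inP=> y yS; apply/implyP=> xy.
  by rewrite -val_eqE /= !ffunE /= !fT // fP.
pose c : {ffun T -> 'I_#|T|.+1} := [ffun x => inord (enum_rank x)].
have cE x : c x = enum_rank x :> nat by rewrite ffunE inordK // ltnS ltnW.
exists c; apply/forall_inP=> x xS; rewrite cE; apply/andP; split.
  by apply: ltn_trans kT; rewrite ltnS ltnW.
apply/forall_inP=> y yS; apply/implyP=> xy.
by rewrite -val_eqE /= !cE val_eqE (inj_eq enum_rank_inj) (adj_neq xy).
Qed.

Fact col_exists S : exists k, col S k.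
Proof.
exists #|T|; apply/colP; exists (fun x => enum_rank x : nat) => // x y _ _ xy.
by rewrite val_eqE (inj_eq enum_rank_inj) (adj_neq xy).
Qed.

Definition chi S := ex_minn (col_exists S).

Lemma chi_le S k f : {in S, forall x, f x < k} -> proper S f -> chi S <= k.
Proof.
by move=> fk fP; rewrite /chi; case: ex_minnP => m _; apply; apply/colP; exists f.
Qed.

Lemma chiP S : exists2 f, {in S, forall x, f x < chi S} & proper S f.
Proof. by apply/colP; rewrite /chi; case: ex_minnP. Qed.

Lemma chiS A B : A \subset B -> chi A <= chi B.
Proof.
move=> /subsetP AB; have [f fB fP] := chiP B.
by apply: (chi_le (f := f)) => [x /AB/fB|x y /AB xB /AB yB]; last exact: fP.
Qed.

Lemma chiU A B : chi (A :|: B) <= chi A + chi B.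
Proof.
have [f fA fP] := chiP A; have [g gB gP] := chiP B.
pose h x := if x \in A then f x else chi A + g x.
apply: (chi_le (f := h)) => [x|x y]; rewrite /h !inE.
  by case: ifP => [/fA|_ /= /gB]; lia.
case: ifP => [xA _|_ /= xB]; case: ifP => [yA _|_ /= yB] xy.
- exact: fP.
- by have := fA x xA; lia.
- by have := fA y yA; lia.
- by have := gP x y xB yB xy; lia.
Qed.

Lemma chiD A B : chi A <= chi (A :\: B) + chi (A :&: B).
Proof. by rewrite -{1}(setID A B) setUC chiU. Qed.

Lemma chi_closed Z A : closed_in e Z A -> chi Z <= maxn (chi A) (chi (Z :\: A)).
Proof.
case=> AZ nA; have [f fA fP] := chiP A; have [g gB gP] := chiP (Z :\: A).
pose h x := if x \in A then f x else g x.
apply: (chi_le (f := h)) => [x xZ|x y xZ yZ xy]; rewrite /h ?leq_max.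
  by case: ifP => xA; [rewrite fA | rewrite gB ?orbT // inE xA].
case: ifP => xA; case: ifP => yA.
- exact: fP.
- by have := nA x y xA; rewrite !inE yA yZ xy => /(_ isT).
- by have := nA y x yA; rewrite !inE xA xZ gsym xy => /(_ isT).
- by apply: gP; rewrite ?inE ?xA ?yA.
Qed.

Lemma chi_indep S : {in S &, forall x y, ~~ e x y} -> chi S <= 1.
Proof.
move=> iS; apply: (chi_le (f := fun=> 0)) => // x y xS yS.
by rewrite (negbTE (iS x y xS yS)).
Qed.

Lemma chi1 x : chi [set x] <= 1.
Proof. by apply: chi_indep => y z /set1P-> /set1P->; rewrite girr. Qed.

Lemma chiD1 S x : chi S <= (chi (S :\ x)).+1.
Proof.
apply: leq_trans (chiD S [set x]) _; rewrite -addn1 leq_add2l.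
by apply: leq_trans (chi1 x); apply: chiS; apply: subsetIr.
Qed.

Lemma chi_gt0 S : (0 < chi S) = (S != set0).
Proof.
apply/idP/idP=> [|/set0Pn[x xS]]; last first.
  by have [f fS _] := chiP S; apply: leq_ltn_trans (fS x xS).
apply: contraTneq => ->; rewrite -leqNgt.
by apply: (chi_le (f := fun=> 0)) => x; rewrite inE.
Qed.

Lemma chi0 : chi set0 = 0.
Proof. by apply/eqP; rewrite -leqn0 leqNgt chi_gt0 eqxx. Qed.

Lemma chi_component Z : Z != set0 -> exists C,
  [/\ closed_in e Z C, connected e C, C != set0 & chi Z <= chi C].
Proof.
move=> Z0; have [||C [Ccl cC ZC]] := @closed_connected T e Z (fun C => chi Z <= chi C).
- exact: leqnn.
- move=> C A _ ZC /chi_closed CA; rewrite -leq_max; exact: leq_trans CA.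
- by exists C; split=> //; rewrite -chi_gt0 (leq_trans _ ZC) // chi_gt0.
Qed.

Lemma chi_bigcup_seq (I : eqType) (s : seq I) (F : I -> {set T}) r :
  {in s, forall i, chi (F i) <= r} -> chi (\bigcup_(i <- s) F i) <= size s * r.
Proof.
elim: s => [|i s IH] sr; first by rewrite big_nil leqNgt chi_gt0 eqxx.
rewrite big_cons mulSn (leq_trans (chiU _ _)) // leq_add ?sr ?mem_head //.
by apply: IH => j js; apply: sr; rewrite inE js orbT.
Qed.

End Chi.

(** * Reduction to neighbourhoods *)

Section LocalChi.
Variables (T : finType) (e : graph T).
Implicit Types (A B C S Z U : {set T}) (x y z p : T).
Local Notation chi := (chi e).

Lemma long_path U r j : {in U, forall x, chi (U :&: nbr e x) <= r} ->
  j * r + 1 < chi U ->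
  exists s, [/\ size s = j.+1, {subset s <= U} & ipath e s].
Proof.
move=> Ur jU; apply: (@gyarfas_path T e U chi r 0 1).
- move=> y yU B BU; apply: leq_trans (chiD _ _ (nbr e y)) _.
  by rewrite leq_add2l; apply: leq_trans (Ur y yU); apply: chiS; apply: setSI.
- move=> Z ZU; rewrite chi_gt0 => Z0.
  by have [B [? ? ? ?]] := chi_component e Z0; exists B; rewrite addn0.
- by move=> C x; apply: chiD1.
- by rewrite addn0 muln0 addn1.
Qed.

Definition ball2 p := [set u | (u == p) || e p u || [exists w, e p w && e w u]].

Section Layers.
Variable p : T.

Fixpoint ball i : {set T} :=
  if i is j.+1 then ball j :|: [set y | [exists x in ball j, e x y]]
  else [set p].

Definition layer i := if i is j.+1 then ball i :\: ball j else ball 0.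

Lemma ball_next i x y : x \in ball i -> e x y -> y \in ball i.+1.
Proof. by move=> xi xy; rewrite /= !inE; apply/orP; right; apply/existsP; exists x; rewrite xi. Qed.

Lemma ballS i j : i <= j -> ball i \subset ball j.
Proof.
elim: j => [|j IH]; first by rewrite leqn0 => /eqP->.
rewrite leq_eqVlt => /orP[/eqP->//|/IH]; move/subset_trans; apply; exact: subsetUl.
Qed.

Lemma ball_prev i y : y \in ball i.+1 -> y \notin ball i ->
  exists2 x, x \in ball i & e x y.
Proof. by rewrite /= !inE => /orP[->//|/existsP[x /andP[xi xy]] _]; exists x. Qed.

Lemma layer_ball i : layer i \subset ball i.
Proof. case: i => // i; exact: subsetDl. Qed.

Lemma layer_far i j x y : x \in ball i -> y \in layer j -> i.+1 < j -> ~~ e x y.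
Proof.
case: j => // j xi; rewrite inE ltnS => /andP[yj _] ij; apply: contra yj => xy.
exact: (subsetP (ballS ij)) (ball_next xi xy).
Qed.

Lemma ball_connected i : connected e (ball i).
Proof.
elim: i => [|i IH] A AB A0 AnB.
  case/eqP: AnB; apply/eqP; rewrite eqEsubset AB /= sub1set.
  by have [x xA] := set0Pn _ A0; move: (subsetP AB x xA) => /set1P<-.
have [D0|D0] := eqVneq (A :&: ball i) set0.
  have [y yA] := set0Pn _ A0.
  have nA x : x \in ball i -> x \notin A.
    by move=> xi; apply/negP=> xA; have := in_set0 x; rewrite -D0 inE xA xi.
  have [x xi xy] : exists2 x, x \in ball i & e x y.
    by apply: ball_prev; [exact: (subsetP AB)|apply: contraL yA => /nA].
  exists y => //; exists x; last by rewrite gsym.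
  by rewrite inE nA // (subsetP (ballS (leqnSn i))).
have [Di|Di] := eqVneq (A :&: ball i) (ball i).
  have iA x : x \in ball i -> x \in A by rewrite -Di inE => /andP[].
  have [y yB yA] : exists2 y, y \in ball i.+1 & y \notin A.
    by move: AnB; rewrite eqEsubset AB => /subsetPn.
  have [x xi xy] : exists2 x, x \in ball i & e x y.
    by apply: ball_prev => //; apply: contra yA => /iA.
  by exists x; [exact: iA | exists y; rewrite // in_setD yA].
have [x] := IH _ (subsetIr _ _) D0 Di; rewrite inE => /andP[xA xi] [y].
rewrite in_setD in_setI negb_and => /andP[/orP[yA|/negbTE->//] yi] xy.
exists x => //; exists y => //; rewrite in_setD yA; exact: (subsetP (ballS (leqnSn i))).
Qed.

(** Distinct layers of the same parity have no edges between them, so they can share colours. *)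
Lemma chi_alternate M b : (forall i, chi (layer i) <= M) ->
  forall k, chi (\bigcup_(i < k) layer (2 * i + b)) <= M.
Proof.
move=> LM; elim=> [|k IH]; first by rewrite big_ord0 chi0.
rewrite big_ord_recr /=; set A := \bigcup_(i < k) _; set B := layer _.
have Acl : closed_in e (A :|: B) A.
  split; first exact: subsetUl.
  move=> x y /bigcupP[i _ xi]; rewrite !inE => /andP[/negbTE-> /= yB].
  apply: layer_far yB _; first exact: (subsetP (layer_ball _)) xi.
  have := ltn_ord i; lia.
apply: leq_trans (chi_closed Acl) _; rewrite geq_max IH; apply: leq_trans (LM (2 * k + b)).
by apply: chiS; apply/subsetP=> x; rewrite in_setD in_setU => /andP[/negbTE->].
Qed.

Lemma ball_saturates : exists k, ball k.+1 = ball k.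
Proof.
have [/existsP[k /eqP kE]|] := boolP [exists k : 'I_#|T|.+1, ball k.+1 == ball k].
  by exists k.
rewrite negb_exists => /forallP H.
suff: forall k, k <= #|T|.+1 -> k < #|ball k|.
  by move/(_ _ (leqnn _)); rewrite ltnNge leqW ?max_card.
elim=> [|k IH] kT; first by rewrite /= cards1.
apply: leq_ltn_trans (IH (ltnW kT)) _; apply: proper_card.
by rewrite properEneq eq_sym (H (Ordinal kT)) ballS.
Qed.

Lemma chi_layers C M : connected e C -> p \in C -> (forall i, ball i \subset C) ->
  (forall i, chi (layer i) <= M) -> chi C <= 2 * M.
Proof.
move=> cC pC BC LM; have [k kE] := ball_saturates.
have Bk : ball k = C.
  apply/eqP/negPn/negP=> Bn.
  have [|x xB [y]] := cC _ (BC k) _ Bn.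
    by apply/set0Pn; exists p; apply: (subsetP (ballS (leq0n k))); rewrite inE.
  by rewrite inE => /andP[yB _] /(ball_next xB); rewrite kE (negbTE yB).
have sub : C \subset \bigcup_(i < k.+1) layer (2 * i + 0) :|: \bigcup_(i < k.+1) layer (2 * i + 1).
  have lev i x : x \in ball i -> exists2 j, j <= i & x \in layer j.
    elim: i => [|i IH] xi; first by exists 0.
    have [/IH[j ji xj]|xni] := boolP (x \in ball i); first by exists j => //; apply: leqW.
    by exists i.+1 => //; rewrite /layer inE xni.
  apply/subsetP=> x; rewrite -Bk => /lev[j jk xj]; rewrite inE.
  have jk2 : j./2 < k.+1 by lia.
  have [oj|ej] := boolP (odd j); apply/orP; [right|left];
    apply/bigcupP; exists (Ordinal jk2) => //=; rewrite (_ : _ + _ = j) //; lia.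
apply: leq_trans (chiS e sub) _; apply: leq_trans (chiU _ _ _) _.
by rewrite mul2n -addnn leq_add ?chi_alternate.
Qed.
End Layers.

Variable n : nat.
Hypothesis n_gt2 : 2 < n.
Hypothesis noC : ~ has_cycle n e.

Definition layer_path_bound := 2 * (n * (3 * n).+1) + n + 1.

(** The vertices at distance two from [p] contain no long induced path by [second_layer_path], so
    [long_path] bounds their chromatic number; [p] and its neighbourhood give the remaining
    terms. *)
Lemma chi_ball2 r p : (forall x, chi (nbr e x) <= r) ->
  chi (ball2 p) <= layer_path_bound.+1 * r + 2.
Proof.
move=> nr; set U := ball2 p :\: (p |: nbr e p).
have Ub : chi U <= layer_path_bound * r + 1.
  rewrite leqNgt; apply/negP=> /long_path[x _|s [ss sU ps]].
    by apply: leq_trans (nr x); apply: chiS; apply: subsetIr.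
  have := second_layer_path n_gt2 (v := p) noC ps.
  rewrite ss -/layer_path_bound ltnn => H; have: false; last by [].
  apply: H => y /sU; rewrite !inE negb_or -andbA => /and3P[yp py].
  rewrite (negbTE yp) (negbTE py) => /existsP[w /andP[pw wy]].
  by split=> //; exists w.
have sub : ball2 p \subset [set p] :|: (nbr e p :|: U).
  apply/subsetP=> x xb; rewrite !(in_setU, in_setD, in_set1) xb andbT negb_or.
  by rewrite /nbr inE; case: (x == p); case: (e p x).
have := leq_trans (chiS e sub) (chiU _ _ _); have := chiU e (nbr e p) U.
have := chi1 e p; have := nr p; rewrite mulSn; move: (layer_path_bound * r) Ub => k; lia.
Qed.

(** The outer 2 stands for the two parities of layers. In a layer, [n.+1] neighbourhoods are given
    up (one for [y], [n] along the Gyarfas path), and [n.+1] balls of radius two must not cover what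
    is left. *)
Definition chi_bound r :=
  2 * ((n.+1) * r + n.+1 * (layer_path_bound.+1 * r + 2) + 1).

(** A component [K] of a layer with large chromatic number contains a path [P] with more than [n]
    vertices, to be closed to a hole through lower layers. The closing vertices must not see [P]
    elsewhere than at its ends: [y] sees only its first vertex, because the rest is sought in
    [K :\: nbr e y], and the other parent [y'] sees none of it, because it is taken below a vertex
    [z] far from [P]. *)
Lemma chi_local r : (forall x, chi (nbr e x) <= r) -> chi [set: T] <= chi_bound r.
Proof.
move=> nr; rewrite leqNgt; apply/negP=> big.
have T0 : [set: T] != set0 by rewrite -(chi_gt0 e); apply: leq_ltn_trans big.
have [C [[_ Ccl] cC C0 TC]] := chi_component e T0.
have [p pC] := set0Pn _ C0.
have BC i : ball p i \subset C.
  elim: i => [|i IH]; first by rewrite /= sub1set.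
  apply/subsetP=> y yB; apply/negPn/negP=> yC.
  have [|x xi xy] := ball_prev yB.
    by apply: contra yC; apply: (subsetP IH).
  have := Ccl x y (subsetP IH x xi); rewrite in_setD yC inE => /(_ isT).
  by rewrite xy.
have [Q QE] : {Q | Q = n.+1 * (layer_path_bound.+1 * r + 2)} by exists (n.+1 * (layer_path_bound.+1 * r + 2)).
have [M ME] : {M | M = n.+1 * r + Q + 1} by exists (n.+1 * r + Q + 1).
suff LM i : chi (layer p i) <= M.
  by have := leq_trans TC (chi_layers cC pC BC LM); rewrite ME QE leqNgt big.
rewrite leqNgt; apply/negP=> Mi {big}.
have ball0r : chi (ball p 0) <= M.
  by by apply: leq_trans (chi1 e p) _; rewrite ME addn1.
have ball1r : chi (layer p 1) <= M.
  apply: (@leq_trans r); last by rewrite ME mulSn -!addnA leq_addr.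
  apply: leq_trans (nr p); apply: chiS; apply/subsetP=> y.
  rewrite !inE => /andP[/negbTE->] /existsP[x /andP[]].
  by rewrite inE => /eqP->.
case: i Mi => [|[|i] Mi]; [by rewrite ltnNge ball0r | by rewrite ltnNge ball1r in Mi |].
set L := layer p i.+2 in Mi.
have LP y : y \in L -> y \in ball p i.+2 /\ y \notin ball p i.+1.
  by rewrite in_setD => /andP[].
have L0 : L != set0 by rewrite -(chi_gt0 e); apply: leq_ltn_trans Mi.
have [K [[KL _] cK K0 LK]] := chi_component e L0.
have {}Mi := leq_trans Mi LK.
have KP y : y \in K -> y \in ball p i.+2 /\ y \notin ball p i.+1.
  by move/(subsetP KL)/LP.
have [c cK0] := set0Pn _ K0.
have [y yB yc] : exists2 y, y \in ball p i.+1 & e y c.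
  by have [? ?] := KP c cK0; apply: ball_prev.
have far u w : u \in ball p i -> w \in K -> ~~ e u w.
  by move=> ui /(subsetP KL) wL; apply: layer_far ui wL _.
have yb : y \notin ball p i by apply: contraL yc => yi; apply: far.
have yK : y \notin K by apply: contraL yB => /KP[].
have drop : forall x B, chi B <= chi (B :\: nbr e x) + r.
  move=> x B; apply: leq_trans (chiD _ _ (nbr e x)) _.
  by rewrite leq_add2l; apply: leq_trans (nr x); apply: chiS; apply: subsetIr.
have [|K' [K'cl cK' K'0 KK']] := @chi_component _ e (K :\: nbr e y).
  rewrite -(chi_gt0 e) -(ltn_add2r r); apply: leq_trans (drop y K); apply: leq_trans Mi.
  by rewrite ME mulSn -addnA -addnA ltnS leq_addr.
have K'P w : w \in K' -> w \in K /\ ~~ e y w.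
  by case: K'cl => /subsetP s _ /s; rewrite !inE => /andP[].
have MK' : n * r + Q + 1 < chi K'.
  rewrite -(ltn_add2r r); apply: leq_trans (leq_trans (drop y K) _); last by rewrite leq_add2r.
  by apply: leq_trans Mi; rewrite ME mulSn addnC !addnA.
have [|x1 x1K [yx1 x1d]] := connected_step cK _ K'cl K'0; first by exists c.
have [||||||s [D [ss sK' ps [DK' cD muD lD sD]]]] :=
  @gyarfas T e setT chi r 0 1 _ _ n x1 K' _ _ _ cK' x1d.
- by move=> x _ B _; apply: drop.
- move=> Z _; rewrite chi_gt0 => Z0.
  by have [B [? ? ? ?]] := chi_component e Z0; exists B; rewrite addn0.
- by rewrite inE.
- exact: subsetT.
- by apply/negP=> /K'P[_]; rewrite yx1.
- by rewrite addn0; apply: ltnW; apply: leq_trans MK'; rewrite ltnS leq_add2r leq_addr.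
set P := x1 :: s.
have DK w : w \in D -> w \in K /\ ~~ e y w by move/(subsetP DK')/K'P.
have PK w : w \in P -> w \in K.
  by rewrite inE => /orP[/eqP->//|/sK'/K'P[]].
(* At distance more than two from [P], so that no parent of [z] has a neighbour in [P]. *)
have [z zD zP] : exists2 z, z \in D & {in P, forall w, z \notin ball2 w}.
  have [sub|/subsetPn[z zD zn]] := boolP (D \subset \bigcup_(w <- P) ball2 w).
    have := leq_trans (chiS e sub) (@chi_bigcup_seq _ e _ P ball2 _ (fun w _ => chi_ball2 w nr)).
    rewrite [size P]/= ss -QE => DQ; move: MK'; rewrite ltnNge; case/negP.
    apply: leq_trans muD _; rewrite addn0 [chi D + _]addnC -addnA leq_add2l.
    by apply: leq_trans DQ (leq_addr _ _).
  exists z => // w wP; apply: contra zn => zw.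
  by rewrite (big_rem w wP) /= in_setU zw.
have [y' y'B y'z] : exists2 y', y' \in ball p i.+1 & e y' z.
  by have [/KP[? ?] _] := DK z zD; apply: ball_prev.
have y'b : y' \notin ball p i.
  by apply: contraL y'z => y'i; apply: far => //; case: (DK z zD).
have y'P w : w \in P -> ~~ e w y'.
  move=> wP; apply: contra (zP w wP) => wy'; rewrite inE; apply/orP; right.
  by apply/existsP; exists y'; rewrite wy'.
have y'K : y' \notin K by apply: contraL y'B => /KP[].
have ball_disj w : w \in ball p i -> w \notin K.
  by move=> wi; apply/negP=> /KP[_]; rewrite (subsetP (ballS p (leqnSn i))).
set l := last x1 s in lD sD.
have lP : l \in P by apply: mem_last.
have [|||||q1 q1D pq1] := @connected_path T e D l y' cD.
- by case: (sD l lP).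
- by apply: contra y'K => /DK[].
- by apply: contraNneq y'K => <-; apply: PK.
- exact: lD.
- by exists z.
have yy' : y' != y.
  by apply: contraTneq yx1 => <-; rewrite gsym y'P ?mem_head.
(* The ball two levels below [K] is connected and has no edge to [K], so the return from [y'] to [y]
   creates no chord. *)
have [||q2 q2B pq2] := @connected_path T e (ball p i) y' y (@ball_connected p i) y'b yb yy'.
- by have [x xi xy'] := ball_prev y'B y'b; exists x => //; rewrite gsym.
- by have [x xi xy'] := ball_prev yB yb; exists x => //; rewrite gsym.
case: q1 q1D pq1 => [|d q1] q1D pq1.
  by move: pq1; rewrite ipath_cons /= inE eqxx => /and3P[_ /andP[]]; rewrite (negbTE (y'P l lP)).
have /ipath_rconsP[pyq2 yq2 eyq2] : ipath e (rcons (y' :: q2) y) by [].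
have /and3P[lq1 /allP elq1 pq1'] := pq1.
have /ipath_rconsP[pdq1 y'q1 ey'q1] : ipath e (rcons (d :: q1) y') by [].
set R := (d :: q1) ++ y' :: q2.
have pR : ipath e R.
  apply/ipath_cat; split=> // u w uq; rewrite inE => /orP[/eqP->|wq].
    rewrite ey'q1 // /= eqxx andbT; split; last exact: eq_sym.
    by apply: contraNneq y'K => <-; case: (DK u (q1D u uq)).
  have [uK _] := DK u (q1D u uq); have wi := q2B w wq; split.
    by apply: contraTneq uK => ->; apply: ball_disj.
  rewrite gsym (negbTE (far _ _ wi uK)) /= (_ : (y' == w) = false) ?andbF //.
  by apply: contraNF y'b => /eqP->.
have headR u : head u R = d by [].
have RK w : w \in R -> [\/ w \in d :: q1, w = y' | w \in q2].
  rewrite mem_cat => /orP[]; first by constructor 1.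
  by rewrite inE => /orP[/eqP|]; [constructor 2 | constructor 3].
have dy' : d != y'.
  by apply: contraNneq y'K => <-; case: (DK d (q1D d (mem_head _ _))).
have pPR : ipath e (P ++ R).
  apply/ipath_cat; split=> // u w uP wR; rewrite headR.
  have lE : last w P = l by [].
  rewrite lE; case: (RK w wR) => [wq|->|wq].
  - have [uD uN] := sD u uP; split; first by apply: contraNneq uD => ->; apply: q1D.
    have [lu|lu] := eqVneq l u; last by apply/negbTE/uN; [rewrite eq_sym | apply: q1D].
    have ws : w \in rcons (d :: q1) y' by rewrite mem_rcons in_cons wq orbT.
    by rewrite -lu (eqP (elq1 w ws)) eq_sym.
  - split; first by apply: contraNneq y'K => <-; apply: PK.
    by rewrite (negbTE (y'P u uP)) (negbTE dy') andbF.
  - have wi := q2B w wq; split; first by apply: contraTneq (PK u uP) => ->; apply: ball_disj.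
    rewrite gsym (negbTE (far _ _ wi (PK u uP))) (_ : (d == w) = false) ?andbF //.
    by apply: contraTF wi => /eqP<-; apply/negP => /ball_disj/negP; apply; case: (DK d (q1D d (mem_head _ _))).
apply: noC; apply: (hole_has_cycle n_gt2 (x := y) (t := P ++ R)); last first.
  by rewrite size_cat [size P]/= ss addSn; apply/leqW/leqW/leq_addr.
split=> //.
- rewrite mem_cat negb_or; apply/andP; split; first by apply: contra yK => /PK.
  apply/negP=> /RK[/q1D/DK[]|yE|].
  + by move=> H; rewrite H in yK.
  + by rewrite yE eqxx in yy'.
  + by move=> H; case/negP: yq2; rewrite inE H orbT.
- move=> w; have lastR : last y (P ++ R) = last y' q2 by rewrite last_cat /= last_cat.
  rewrite lastR [head _ _]/= mem_cat.
  have lastK u : u \in y' :: q2 -> u \notin K.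
    by rewrite inE => /orP[/eqP->//|/q2B/ball_disj].
  have inK u : u \in K -> ~~ e y u -> e y u = (u == x1) || (u == last y' q2).
    move=> uK /[dup] yu /negbTE->; symmetry; apply/negbTE; rewrite negb_or.
    apply/andP; split; first by apply: contraNneq yu => ->.
    by apply: contraTneq uK => ->; apply/lastK/mem_last.
  case/orP; first rewrite inE => /orP[/eqP->|ws]; first by rewrite eqxx yx1.
    by have [wK yw] := K'P w (sK' w ws); apply: inK.
  rewrite mem_cat => /orP[/q1D/DK[wK yw]|wq]; first exact: inK.
  rewrite gsym eyq2 //= (_ : (w == x1) = false) //.
  by apply: contraNF (lastK w wq) => /eqP->.
Qed.

End LocalChi.

(** * Alternating orders *)

Section Threshold.
Variables (T : finType) (n : nat).
Hypothesis n_gt2 : 2 < n.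
Implicit Types (e : graph T) (v x y z c : T) (D h : seq T).

(** A threshold graph, listed with dominating and isolated vertices in strict alternation. *)
Fixpoint alternating e b D :=
  if D is c :: D' then all (fun d => e c d == b) D' && alternating e (~~ b) D'
  else true.

Fixpoint alternating_row e z b D :=
  if D is c :: D' then (e z c == b) && alternating_row e z (~~ b) D' else true.

Lemma alternating_lc e c b D : uniq D -> {in D, forall d, e c d} ->
  alternating e b D -> alternating (lc e c) (~~ b) D.
Proof.
elim: D b => //= d D IH b /andP[dD uD] cD /andP[/allP aD altD].
apply/andP; split; last first.
  by apply: IH => // x xD; apply: cD; rewrite inE xD orbT.
apply/allP=> x xD; rewrite lc_flip ?cD ?mem_head ?inE ?xD ?orbT //.
  by rewrite (eqP (aD x xD)).
by apply: contraNneq dD => ->.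
Qed.

Lemma alternating_row_lc e c z b D : z \notin D -> e c z -> {in D, forall d, e c d} ->
  alternating_row e z b D -> alternating_row (lc e c) z (~~ b) D.
Proof.
elim: D b => //= d D IH b; rewrite inE negb_or => /andP[zd zD] cz cD /andP[/eqP zdb r].
rewrite lc_flip // ?cD ?mem_head // zdb eqxx /=.
by apply: IH => // x xD; apply: cD; rewrite inE xD orbT.
Qed.

Lemma alternating_row_id e c z b D : ~~ e c z -> alternating_row e z b D ->
  alternating_row (lc e c) z b D.
Proof.
move=> cz; elim: D b => //= d D IH b /andP[zd /IH->].
by rewrite lc_id ?zd // (negbTE cz).
Qed.

Lemma lc_cons_path e c a h : ipath e (a :: h) -> c \notin a :: h -> e c a ->
  {in h, forall x, ~~ e x c} -> ipath (lc e c) [:: c, a & h].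
Proof.
move=> p cah ca hc; have eca x : x \in a :: h -> e c x = (x == a).
  rewrite inE => /orP[/eqP->|xh]; first by rewrite ca eqxx.
  rewrite gsym (negbTE (hc x xh)); symmetry.
  by move: (ipath_uniq p) => /= /andP[ah _]; apply: contraNF ah => /eqP<-.
apply: ipath_consP => // [|x xah]; last by rewrite lc_self eca.
rewrite -(eq_ipath (e := e)) // => x y xs ys; symmetry; apply: lc_id.
by rewrite !eca // => /eqP-> /eqP->.
Qed.

(* Complementing at the successive vertices of [D] moves the vertex that
   dominates the rest of the order to the next one, and so turns the order
   into a path. *)
Lemma threshold_path e a h D y :
  h != [::] -> ipath e (a :: h) -> uniq (rcons D y) ->
  {in rcons D y, forall d, d \notin a :: h} ->
  alternating e true (rcons D y) -> {in rcons D y, forall d, e a d} ->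
  {in h & D, forall x d, ~~ e x d} ->
  {in h, forall x, e x y = (x == last a h)} ->
  n <= size D + size h + 2 -> has_cycle n e.
Proof.
elim: D e a h => [|c D IH] e a h h0 p uD Dh altD aD hD hy.
  move=> nh; apply: (hole_has_cycle n_gt2 (x := y) (t := a :: h)); last by rewrite add0n addn2 in nh.
  split=> //; first by apply: Dh; rewrite inE.
  move=> x; rewrite inE gsym => /orP[/eqP->|xh]; first by rewrite aD ?inE ?eqxx.
  rewrite hy // /= (_ : (x == a) = false) //.
  by move: (ipath_uniq p) => /= /andP[ah _]; apply: contraNF ah => /eqP<-.
move=> nh; move: uD altD => /= /andP[cD uD] /andP[/allP cAll altD].
have sub d : d \in rcons D y -> d \in rcons (c :: D) y by rewrite !mem_rcons !inE orbCA => ->; rewrite orbT.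
have cy : c \in rcons (c :: D) y by rewrite mem_rcons !inE eqxx orbT.
have ca : e c a by rewrite gsym aD.
have cd d : d \in rcons D y -> e c d by move=> dD; rewrite (eqP (cAll d dD)).
have ch : {in h, forall x, ~~ e x c} by move=> x xh; apply: hD; rewrite ?mem_head.
have dc d : d \in rcons D y -> d != c by move=> dD; apply: contraNneq cD => <-.
have lch x : x \in h -> forall d, lc e c x d = e x d.
  by move=> xh d; apply: lc_id; rewrite gsym (negbTE (ch x xh)).
have ah : a \notin h by move: (ipath_uniq p) => /andP[].
have lca d : d \in rcons D y -> lc e c a d = false.
  move=> dD; rewrite lc_flip // ?cd // ?aD ?sub //.
  by apply: contraNneq (Dh d (sub d dD)) => ->; rewrite mem_head.
apply: (@has_cycle_lc _ _ _ c); apply: (IH _ c (a :: h)) => //=.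
- by apply: lc_cons_path => //; apply: Dh.
- by move=> d dD; rewrite inE negb_or dc // Dh ?sub.
- by apply: (alternating_lc (b := false)).
- by move=> d dD; rewrite lc_self cd.
- move=> x d; rewrite inE => /orP[/eqP->|xh] dD; first by rewrite lca // mem_rcons inE dD orbT.
  by rewrite lch // hD // inE dD orbT.
- move=> x; rewrite inE => /orP[/eqP->|xh]; last by rewrite lch ?hy.
  rewrite lca ?mem_rcons ?mem_head //; symmetry; apply: contraNF ah => /eqP->.
  by case: (h) h0 => //= u s _; apply: mem_last.
- by move: nh => /=; lia.
Qed.

(** For [b = false] the edge from [v] to [x] is the initial path of [threshold_path]. For
    [b = true], complementing at [v] first exchanges edges and non-edges among the other vertices
    and leads to the same situation. *)
Lemma threshold_ends e v b x D y :
  uniq (x :: rcons D y) -> e v x -> {in rcons D y, forall d, e v d} ->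
  {in D, forall d, e x d = b} -> e x y = ~~ b ->
  alternating e (~~ b) (rcons D y) -> n <= size D + 3 -> has_cycle n e.
Proof.
case: b => uD vx vD xD xy altD nD; last first.
  move: uD => /andP[xnD uD].
  apply: (@threshold_path e v [:: x] D y) => //=; last by lia.
  - by apply: ipath_consP; rewrite ?inE ?(adj_neq vx) // => u; rewrite inE => /eqP->; rewrite vx eqxx.
  - move=> d dD; rewrite !inE negb_or eq_sym (adj_neq (vD d dD)) /=.
    by apply: contraNneq xnD => <-.
  - by move=> u d; rewrite inE => /eqP-> /xD->.
  - by move=> u; rewrite inE => /eqP->; rewrite xy eqxx.
move: uD => /andP[xnD uD]; apply: (@has_cycle_lc _ _ _ v).
have xNd d : d \in rcons D y -> x != d by move=> dD; apply: contraNneq xnD => ->.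
have Dy d : d \in D -> d \in rcons D y by rewrite mem_rcons inE orbC => ->.
apply: (@threshold_path _ v [:: x] D y) => //=; last by lia.
- apply: ipath_consP; rewrite ?inE ?(adj_neq vx) // => u; rewrite inE => /eqP->.
  by rewrite lc_self vx eqxx.
- move=> d dD; rewrite !inE negb_or eq_sym (adj_neq (vD d dD)) /=.
  by rewrite eq_sym xNd.
- by apply: (alternating_lc (b := false)).
- by move=> d dD; rewrite lc_self vD.
- by move=> u d; rewrite inE => /eqP-> dD; rewrite lc_flip // ?xD ?vD ?xNd ?Dy.
- move=> u; rewrite inE => /eqP->; rewrite eqxx lc_flip // ?xy ?vD ?xNd //.
    by rewrite mem_rcons mem_head.
  by rewrite mem_rcons mem_head.
Qed.

(** Same motion as in [threshold_path], but [z] closes the hole. As [z] sees every vertex at which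
    one complements, its adjacency to the former end [a] is flipped each time, and [z] sees exactly
    the two ends of the growing path. *)
Lemma reversed_row_path e a h D z :
  ipath e (a :: h) -> uniq D -> z \notin D -> z \notin a :: h ->
  {in D, forall d, d \notin a :: h} ->
  alternating e true D -> alternating_row e z true D -> {in D, forall d, e a d} ->
  {in h & D, forall x d, ~~ e x d} ->
  {in a :: h, forall x, e z x = (h != [::]) && ((x == a) || (x == last a h))} ->
  n <= size D + size h + 2 -> has_cycle n e.
Proof.
elim: D e a h => [|c D IH] e a h p uD zD zh Dh altD zrow aD hD ze nh.
  apply: (hole_has_cycle n_gt2 (x := z) (t := a :: h)); last by rewrite add0n addn2 in nh.
  split=> // x xh; rewrite ze //=.
  by case: (h) nh => //=; lia.
move: uD altD zrow zD => /= /andP[cD uD] /andP[/allP cAll altD] /andP[/eqP zc zrow].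
rewrite inE negb_or => /andP[zNc zD].
have ca : e c a by rewrite gsym aD ?mem_head.
have cd d : d \in D -> e c d by move=> dD; rewrite (eqP (cAll d dD)).
have ch : {in h, forall x, ~~ e x c} by move=> x xh; apply: hD; rewrite ?mem_head.
have dc d : d \in D -> d != c by move=> dD; apply: contraNneq cD => <-.
have sub d : d \in D -> d \in c :: D by rewrite inE orbC => ->.
have lch x : x \in h -> forall d, lc e c x d = e x d.
  by move=> xh d; apply: lc_id; rewrite gsym (negbTE (ch x xh)).
have cah : c \notin a :: h by apply: Dh; apply: mem_head.
have ah : a \notin h by move: (ipath_uniq p) => /andP[].
apply: (@has_cycle_lc _ _ _ c); apply: (IH _ c (a :: h)) => //.
- exact: lc_cons_path.
- by rewrite inE negb_or zNc zh.
- by move=> d dD; rewrite inE negb_or dc // Dh ?sub.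
- by apply: (alternating_lc (b := false)).
- by apply: (alternating_row_lc (b := false)); rewrite // gsym zc.
- by move=> d dD; rewrite lc_self cd.
- move=> x d; rewrite inE => /orP[/eqP->|xh] dD; last by rewrite lch // hD // inE dD orbT.
  rewrite lc_flip // ?cd // ?aD ?sub //.
  by apply: contraNneq (Dh d (sub d dD)) => <-; rewrite mem_head.
- have zNa : z != a by apply: contraNneq zh => ->; apply: mem_head.
  move=> x; rewrite inE => /orP[/eqP->|]; first by rewrite lc_id ?zc ?eqxx // girr.
  rewrite inE => /orP[/eqP->|xh].
    have cz : e c z by rewrite gsym zc.
    rewrite lc_flip // ze ?mem_head // eqxx andbT /= [a == c]eq_sym.
    rewrite (negbTE (adj_neq ca)) /= negbK.
    case: (h) ah => [|u s] ah /=; first by rewrite !eqxx.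
    by symmetry; apply: contraNF ah => /eqP->; apply: mem_last.
  rewrite gsym lch // gsym ze ?inE ?xh ?orbT //=.
  have -> : (x == a) = false by apply: contraNF ah => /eqP<-.
  have -> : (x == c) = false by apply: contraNF cah => /eqP<-; rewrite inE xh orbT.
  by case: (h) xh.
- by move: nh => /=; lia.
Qed.

(** Complementing at [c], which [z] does not see, flips the order behind [c] but not the row of [z];
    this brings both into the phase that [reversed_row_path] requires. *)
Lemma reversed_row e c D z : uniq (c :: D) -> z \notin c :: D ->
  alternating e true (c :: D) -> alternating_row e z false (c :: D) ->
  n <= size D + 2 -> has_cycle n e.
Proof.
move=> /andP[cD uD]; rewrite inE negb_or => /andP[zc zD] /andP[/allP cAll altD] /andP[/eqP ezc zrow] nD.
have cd d : d \in D -> e c d by move=> dD; rewrite (eqP (cAll d dD)).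
apply: (@has_cycle_lc _ _ _ c); apply: (@reversed_row_path _ c [::] D z) => //.
- by rewrite inE.
- by move=> d dD; rewrite inE; apply: contraNneq cD => <-.
- by apply: (alternating_lc (b := false)).
- by apply: alternating_row_id; rewrite // gsym ezc.
- by move=> d dD; rewrite lc_self cd.
- by move=> x; rewrite inE => /eqP->; rewrite lc_id ?ezc // girr.
- by rewrite addn0.
Qed.
End Threshold.

(** * Chains *)

Section Chain.
Variables (T : finType) (n : nat).
Hypothesis n_gt2 : 2 < n.
Implicit Types (e : graph T) (u v x y : T) (D h : seq T) (a b c t : bool) (ts : bitseq).

(* Each vertex distinguishes its successor from all later vertices, to which it
   has the constant adjacency [t]. *)
Fixpoint chain e ts D :=
  match ts, D with
  | t :: ts', u :: D' =>
      all (fun d => e u d == t (+) (d == head u D')) D' && chain e ts' D'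
  | [::], [::] => true
  | _, _ => false
  end.

Definition row e x a b D := all (fun d => e x d == a (+) (b && (d == head x D))) D.

Lemma eq_chain e e' ts D : {in D &, forall x y, e x y = e' x y} ->
  chain e ts D -> chain e' ts D.
Proof.
elim: D ts => [|u D IH] [|t ts] //= eqe /andP[/allP a ch]; apply/andP; split.
  by apply/allP=> d dD; rewrite -eqe ?inE ?eqxx ?dD ?orbT ?a.
by apply: IH => // x y xD yD; apply: eqe; rewrite inE ?xD ?yD orbT.
Qed.

Lemma chain_negb e e' ts D : uniq D ->
  {in D &, forall x y, x != y -> e' x y = ~~ e x y} ->
  chain e ts D -> chain e' (map negb ts) D.
Proof.
elim: D ts => [|u D IH] [|t ts] //= /andP[uD uniqD] eqe /andP[/allP a ch]; apply/andP; split.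
  apply/allP=> d dD; rewrite eqe ?inE ?eqxx ?dD ?orbT //; last by apply: contraNneq uD => ->.
  by rewrite (eqP (a d dD)) addNb.
by apply: IH => // x y xD yD; apply: eqe; rewrite inE ?xD ?yD orbT.
Qed.

(** Signs after complementing at a vertex of sign [t]. For [true] it sees all later vertices but the
    next one, whose row survives while the others are reversed; for [false] it sees only the next
    one and nothing changes. *)
Definition flip t ts := if t then take 1 ts ++ map negb (drop 1 ts) else ts.

Lemma chain_lc e t ts u D : uniq (u :: D) -> chain e (t :: ts) (u :: D) ->
  chain (lc e u) (flip t ts) D.
Proof.
case: D ts => [|d D] [|t1 ts] //=;
  [by rewrite /flip; case: t | by rewrite !andbF |].
move=> /andP[_ /andP[dD uD]] /andP[/andP[/eqP ud /allP uDt] /andP[/allP dt ch]].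
rewrite eqxx addbT in ud.
have udE x : x \in D -> e u x = t.
  move=> xD; rewrite (eqP (uDt x xD)) (_ : (x == d) = false) ?addbF //.
  by apply: contraNF dD => /eqP<-.
case: t ud udE {uDt} => ud udE.
  rewrite /flip /= take0 drop0 /=; apply/andP; split.
    by apply/allP=> x xD; rewrite lc_id ?dt // ud.
  apply: chain_negb ch => // x y xD yD xy.
  by rewrite lc_flip ?udE.
rewrite /flip; apply: (@eq_chain e) => /=; last first.
  by apply/andP; split=> //; apply/allP.
move=> x y xD yD; symmetry; apply: lc_id.
have N z : z \in d :: D -> e u z -> z = d.
  by rewrite inE => /orP[/eqP//|/udE->].
by move=> /(N _ xD)-> /(N _ yD)->.
Qed.

(** Over GF(2), a vertex that sees [u] gets the row of [u] added to its own; hence the new indicator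
    bit is the old entry at [u]. *)
Lemma row_lc e x a b t ts u D : uniq (u :: D) -> x \notin u :: D ->
  chain e (t :: ts) (u :: D) -> row e x a b (u :: D) ->
  row (lc e u) x (if a (+) b then a (+) t else a) (a (+) b) D.
Proof.
rewrite /row /= eqxx andbT => /andP[uD uniqD]; rewrite inE negb_or => /andP[xu xD].
case/andP=> /allP ch _ /andP[/eqP xuE /allP xDE]; apply/allP=> d dD.
have xd : x != d by apply: contraNneq xD => ->.
have -> : head x D = head u D by case: (D) dD.
have du : (d == u) = false by apply: contraNF uD => /eqP<-.
rewrite lcE // [e u x]gsym xuE (eqP (ch d dD)) (eqP (xDE d dD)) du andbF addbF.
by case: (a (+) b); rewrite /= ?addbF //; rewrite -addbA addbC [in X in _ == X]addbC addbA.
Qed.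

Lemma row_tail e x a b u D : uniq (u :: D) -> row e x a b (u :: D) -> row e x a false D.
Proof.
rewrite /row /= => /andP[uD _] /andP[_ /allP xD]; apply/allP=> d dD.
rewrite (eqP (xD d dD)) (_ : (d == u) = false) ?andbF //.
by apply: contraNF uD => /eqP<-.
Qed.

(* An induced path [x :: rcons h y], up to a possible chord [c] between its
   ends, whose inner vertices see nothing of the rest [D] of the chain, while
   the rows of [x] and [y] on [D] are linear combinations of the all-one row
   and of the indicator of the next vertex. *)
Record state e x h y c a b a' b' ts D : Prop := State {
  st_l : ipath e (x :: h);
  st_r : ipath e (rcons h y);
  st_xy : e x y = c;
  st_neq : x != y;
  st_uniq : uniq D;
  st_out : {in D, forall d, d \notin x :: rcons h y};
  st_h : {in h & D, forall z d, ~~ e z d};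
  st_chain : chain e ts D;
  st_rowl : row e x a b D;
  st_rowr : row e y a' b' D }.

Lemma state_sym e x h y c a b a' b' ts D : state e x h y c a b a' b' ts D ->
  state e y (rev h) x c a' b' a b ts D.
Proof.
case=> pl pr xy nxy uD out hD ch rl rr; split=> //.
- by rewrite -rev_rcons ipath_rev.
- by rewrite -rev_cons ipath_rev.
- by rewrite gsym.
- by rewrite eq_sym.
- move=> d /out; rewrite !inE !mem_rcons !inE mem_rev.
  by rewrite !negb_or => /and3P[-> -> ->].
- by move=> z d; rewrite mem_rev; apply: hD.
Qed.

Lemma state_lc e x h y c a b a' b' t ts u D :
  state e x h y c a b a' b' (t :: ts) (u :: D) ->
  state (lc e u) x h y (c (+) ((a (+) b) && (a' (+) b')))
    (if a (+) b then a (+) t else a) (a (+) b)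
    (if a' (+) b' then a' (+) t else a') (a' (+) b') (flip t ts) D.
Proof.
case=> pl pr xy nxy uD out hD ch rl rr.
have hu z : z \in h -> e u z = false by move=> zh; rewrite gsym; apply/negbTE/hD; rewrite ?mem_head.
have lch z w : z \in h -> lc e u z w = e z w by move=> zh; apply: lc_id; rewrite hu.
have lch' z w : z \in h -> lc e u w z = e w z by move=> zh; rewrite gsym lch // gsym.
have sub d : d \in D -> d \in u :: D by rewrite inE orbC => ->.
have xuD z : z \in x :: rcons h y -> z \notin u :: D by move=> zin; apply: contraL zin => /out.
have ux : e u x = a (+) b.
  by move: rl => /= /andP[/eqP]; rewrite /= eqxx andbT gsym => ->.
have uy : e u y = a' (+) b'.
  by move: rr => /= /andP[/eqP]; rewrite /= eqxx andbT gsym => ->.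
have yin : y \in x :: rcons h y by rewrite inE mem_rcons mem_head orbT.
split=> //.
- rewrite -(eq_ipath (e := e)) // => z w; rewrite !inE => /orP[/eqP->|zh] /orP[/eqP->|wh].
  + by rewrite !girr.
  + by rewrite lch'.
  + by rewrite lch.
  + by rewrite lch.
- rewrite -(eq_ipath (e := e)) // => z w; rewrite !mem_rcons !inE => /orP[/eqP->|zh] /orP[/eqP->|wh].
  + by rewrite !girr.
  + by rewrite lch'.
  + by rewrite lch.
  + by rewrite lch.
- by rewrite lcE // ux uy xy addbC.
- by case/andP: uD.
- by move=> d /sub/out.
- by move=> z d zh dD; rewrite lch // hD // sub.
- exact: chain_lc.
- by apply: row_lc ch rl; rewrite // xuD ?mem_head.
- by apply: row_lc ch rr; rewrite // xuD.
Qed.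

(** With these bits [y] sees [u] and nothing later in the chain, so [u] can become the new end of
    the path and [y] an inner vertex. *)
Lemma state_absorb e x h y a b t ts u D : 0 < size h ->
  state e x h y false a b false true (t :: ts) (u :: D) ->
  state e x (rcons h y) u (a (+) b) a false t true ts D.
Proof.
move=> h0 [pl pr xy nxy uD out hD ch rl rr].
have sub d : d \in D -> d \in u :: D by rewrite inE orbC => ->.
have := out u (mem_head _ _); rewrite inE negb_or => /andP[ux uh].
have xu : e x u = a (+) b by move: rl => /= /andP[/eqP]; rewrite /= eqxx andbT.
have yu : e y u by move: rr => /= /andP[/eqP->]; rewrite eqxx.
have y0 := row_tail uD rr.
move: uD => /[dup] uD0 /andP[unD uD].
move: ch => /= /andP[chu ch].
split=> //.
- apply: ipath_consP => //.
    rewrite mem_rcons inE negb_or nxy /=.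
    by move: (ipath_uniq pl) => /andP[].
  move=> z; rewrite mem_rcons inE => /orP[/eqP->|zh].
    rewrite xy; symmetry; case: (h) h0 pr => // w s _ /ipath_rconsP[_ yh _] /=.
    by apply: contraNF yh => /eqP->; apply: mem_head.
  move: pl => /and3P[_ /allP/(_ z zh)/eqP-> _].
  by case: (h) zh.
- apply: ipath_rcons => // z; rewrite last_rcons mem_rcons inE => /orP[/eqP->|zh].
    by rewrite yu eqxx.
  rewrite (negbTE (hD z u zh (mem_head _ _))); symmetry.
  by case/ipath_rconsP: pr => _ yh _; apply: contraNF yh => /eqP<-.
- by rewrite eq_sym.
- move=> d dD; move: (out d (sub d dD)); rewrite !inE !mem_rcons !inE !negb_or.
  case/and3P=> -> dy dh; rewrite mem_rcons inE negb_or dy dh !andbT /=.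
  by apply: contraNneq unD => <-.
- move=> z d; rewrite mem_rcons inE => /orP[/eqP->|zh] dD; last by rewrite hD ?sub.
  by move/allP: y0 => /(_ d dD)/eqP->.
- exact: row_tail uD0 rl.
Qed.

Lemma state_hole e x h y a b a' b' ts D : state e x h y true a b a' b' ts D ->
  n <= size h + 2 -> has_cycle n e.
Proof.
case=> pl pr xy nxy _ _ _ _ _ _ nh; apply: (hole_has_cycle n_gt2 (x := y) (t := x :: h)).
  split=> //.
    by rewrite inE negb_or eq_sym nxy; case/ipath_rconsP: pr.
  have yx z : z \in h -> e y z = (z == last x h).
    move=> zh; rewrite gsym; case/ipath_rconsP: pr => _ _ -> //.
    by case: (h) zh.
  move=> z; rewrite inE gsym => /orP[/eqP->|zh]; first by rewrite xy eqxx.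
  rewrite gsym yx //= (_ : (z == x) = false) //.
  by apply: contraTF zh => /eqP->; move: (ipath_uniq pl) => /andP[].
by move: nh; rewrite addn2.
Qed.

(** The least number of neighbours that [fan] accepts. That many leading [false] signs form an
    induced path, which must not be seen entirely by one vertex. *)
Definition zeros := (3 * n).+2.

Lemma chain_ipath e ts D k : uniq D -> chain e ts D -> k <= find id ts ->
  ipath e (take k D).
Proof.
elim: D ts k => [|u D IH] [|t ts] [|k] //= /andP[uD uniqD] /andP[/allP a ch].
case: t a => // a; rewrite ltnS => kf; apply: ipath_consP; first exact: IH ch kf.
  by apply: contra uD; apply: mem_take.
move=> d dD; rewrite (eqP (a d (mem_take dD))) /=.
by case: (D) k {IH kf} dD => [|w s] [|k].
Qed.

Lemma state_fan e x h y c a' b' ts D : state e x h y c true false a' b' ts D ->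
  zeros <= find id ts -> zeros <= size D -> has_cycle n e.
Proof.
case=> _ _ _ _ uD out _ ch /allP rl _ zf zD.
apply: (fan n_gt2 (u := x) (chain_ipath uD ch zf)).
  by apply/negP=> /mem_take /out; rewrite mem_head.
have -> : count (e x) (take zeros D) = size (take zeros D).
  by apply/eqP; rewrite -all_count; apply/allP=> d /mem_take/rl/eqP->.
by rewrite size_takel.
Qed.

(** If [b] is true, complementing at the head of the chain exchanges the roles of the ends: a sign
    [true] produces the row with bits [false], [true] that [state_absorb] needs, a sign [false]
    reproduces the same situation. A long run of [false] is excluded by [state_fan]. *)
Lemma state_balance e x h y c b ts D m :
  state e x h y c true false b true ts D -> zeros + m <= size D ->
  has_cycle n e \/ exists e' x' h' y' ts' D',
    [/\ has_cycle n e' -> has_cycle n e, size h' = size h, m <= size D' &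
        state e' x' h' y' c true false false true ts' D'].
Proof.
move=> st zD; case: b st => st; last first.
  by right; exists e, x, h, y, ts, D; split=> //; apply: leq_trans zD; apply: leq_addl.
have [zf|fz] := leqP zeros (find id ts).
  by left; apply: state_fan st zf _; apply: leq_trans zD; apply: leq_addr.
right; have {fz}zD : (find id ts).+1 + m <= size D.
  by apply: leq_trans zD; rewrite leq_add2r.
elim: D ts e x h y st zD => [|u D IH] [|t ts] e x h y st; rewrite ?addSn //=.
  by case: st => _ _ _ _ _ _ _ /=.
move=> zD; have := state_lc st; rewrite /= addbF.
case: t st zD => st zD.
  rewrite /= => /state_sym st'; exists (lc e u), y, (rev h), x, (flip true ts), D.
  by split; rewrite ?size_rev //; exact: has_cycle_lc.
move=> /state_sym st'.
have [|e' [x' [h' [y' [ts' [D' [hc sh sD st'']]]]]]] := IH _ _ _ _ _ st'.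
  exact: zD.
exists e', x', h', y', ts', D'; split=> //; last by rewrite sh size_rev.
by move/hc; apply: has_cycle_lc.
Qed.

(** Each round lengthens [h] by one vertex. It spends at most [zeros] chain vertices on balancing,
    at most one on removing the chord, and one on the new end. *)
Lemma state_has_cycle j e x h y c b ts D :
  state e x h y c true false b true ts D -> 0 < size h -> n <= size h + j ->
  (zeros + 3) * j.+1 <= size D -> has_cycle n e.
Proof.
elim: j e x h y c b ts D => [|j IH] e x h y c b ts D st h0 nh sD.
  rewrite muln1 in sD.
  case: (state_balance (m := 3) st sD) => [//|[e' [x' [h' [y' [ts' [D' [hc sh sD' st']]]]]]]].
  apply: hc; rewrite -sh in nh h0; case: c {st} st' => st'.
    by apply: state_hole st' _; apply: leq_trans nh _; rewrite leq_add2l.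
  case: D' ts' sD' st' => [|u D'] [|t ts'] //= _ st'; first by case: st'.
  apply: state_hole (state_absorb h0 st') _.
  by rewrite size_rcons; apply: leq_trans nh _; rewrite addn0 addSn; apply/leqW/leq_addr.
rewrite mulnS -addnA in sD.
case: (state_balance st sD) => [//|[e' [x' [h' [y' [ts' [D' [hc sh sD' st']]]]]]]].
apply: hc; rewrite -sh in nh h0; case: c {st} st' => st'; last first.
  case: D' ts' sD' st' => [|u D'] [|t ts'] //= sD' st'; first by case: st'.
  apply: IH (state_absorb h0 st') _ _ _; first by rewrite size_rcons.
    by rewrite size_rcons addSnnS.
  by move: sD'; rewrite addSn ltnS; apply/leq_trans/leq_addl.
case: D' ts' sD' st' => [|u [|w D']] [|t [|t1 ts']] //= sD' st';
  try by case: st' => _ _ _ _ _ _ _ /=; rewrite ?andbF.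
(* Both ends see [u], so the chord disappears. Their constant bits become [~~ t] and [t], so
   whatever [t] is, exactly one end is ready to absorb. *)
have := state_lc st'; move: (flip _ _) => ts'' /= st''.
have {st''} [x2 [h2 [y2 [sh2 st2]]]] : exists x2 h2 y2, size h2 = size h' /\
    state (lc e' u) x2 h2 y2 false true true false true ts'' (w :: D').
  case: t st' st'' => _ st''; last by exists x', h', y'.
  by exists y', (rev h'), x'; rewrite size_rev; split=> //; apply: state_sym.
apply: (@has_cycle_lc _ _ _ u); rewrite -sh2 in nh h0.
case: ts'' st2 => [|t2 ts''] st2; first by case: st2.
apply: IH (state_absorb h0 st2) _ _ _; first by rewrite size_rcons.
  by rewrite size_rcons addSnnS.
by move: sD'; rewrite !addSn add0n !ltnS; apply/leq_trans/leqnSn.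
Qed.

Lemma chain_has_cycle e v ts D : uniq D -> {in D, forall d, e v d} ->
  chain e ts D -> (zeros + 3) * n.+1 + 2 <= size D -> has_cycle n e.
Proof.
(* Complementing at [v] reverses all signs. With first sign [false], the vertex [u] sees only [w]
   later on and is the inner vertex of the initial path from [v] to [w]. *)
wlog : e ts / ~~ head true ts.
  move=> H uD vD ch sD; have [ht|ht] := boolP (head true ts); last exact: H ht uD vD ch sD.
  have vne d : d \in D -> v != d by move/vD; apply: adj_neq.
  apply: (@has_cycle_lc _ _ _ v); apply: (H _ (map negb ts)) => //.
  - case: ts ht ch sD => [|[] ts] //; case: (D) => // _ _; rewrite addn2 //.
  - by move=> d dD; rewrite lc_self vD.
  - by apply: chain_negb ch => // x y xD yD xy; rewrite lc_flip ?vD.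
case: D ts => [|u [|w D]] [|t [|t1 ts]] //=; rewrite ?addn2 ?andbF //.
case: t => // _ /and3P[]; rewrite inE negb_or => /andP[uw uD] wD uniqD vD.
case/and3P=> /andP[uw1 /allP uDt] /allP wDt ch; rewrite !ltnS => sD.
have st : state e v [:: u] w true true false t1 true ts D.
  split=> //.
  - by rewrite !ipath_cons /= inE (adj_neq (vD u _)) ?vD ?eqxx ?inE ?eqxx.
  - rewrite !ipath_cons /= inE uw; move: uw1; rewrite eqxx => /eqP->.
    by rewrite eqxx.
  - by rewrite vD // !inE eqxx orbT.
  - by apply: (@adj_neq _ e); rewrite vD // !inE eqxx orbT.
  - move=> d dD; rewrite !inE !negb_or eq_sym (@adj_neq _ e) ?vD ?inE ?dD ?orbT //=.
    by apply/andP; split; [apply: contraNneq uD => <- | apply: contraNneq wD => <-].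
  - move=> z d; rewrite inE => /eqP-> dD; rewrite (eqP (uDt d dD)) /=.
    by apply: contraNN wD => /eqP<-.
  - by apply/allP=> d dD; rewrite vD // !inE dD !orbT.
  - apply/allP=> d dD; rewrite (eqP (wDt d dD)).
    by case: (D) dD.
by apply: (state_has_cycle st (j := n)) => //; apply: leqW.
Qed.

End Chain.

(** * Spines in modular primes *)

Section Spine.
Variables (T : finType) (e : graph T) (n : nat) (v : T) (S : {set T}).
Hypothesis n_gt2 : 2 < n.
Hypothesis noC : ~ has_cycle n e.
Hypothesis Sv : {in S, forall x, e v x}.
Implicit Types (x y z u c d : T) (p q : T * T) (ps qs : seq (T * T)).

Definition follows p u := [&& e p.1 u, u != p.2 & ~~ e p.2 u].

(** Flattened, this is a threshold order; keeping pairs allows sublists to be taken without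
    destroying the alternation. *)
Definition spine ps :=
  [&& pairwise (fun p q => follows p q.1 && follows p q.2) ps,
      all (fun p => e p.1 p.2) ps & all (fun p => (p.1 \in S) && (p.2 \in S)) ps].

Definition tail_set ps := [set u in S | all (follows^~ u) ps].

Definition flat ps := flatten [seq [:: p.1; p.2] | p <- ps].

Lemma flatP ps u : u \in flat ps -> exists2 p, p \in ps & (u == p.1) || (u == p.2).
Proof. by move=> /flatten_mapP[p pps]; rewrite !inE; exists p. Qed.

Lemma follows_neq p u : follows p u -> (p.1 != u) && (p.2 != u).
Proof. by case/and3P=> /adj_neq-> up _; rewrite eq_sym up. Qed.

Lemma flat_alternating ps y : spine ps -> all (follows^~ y) ps ->
  alternating e true (rcons (flat ps) y) /\ uniq (rcons (flat ps) y).
Proof.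
elim: ps => // p ps IH /and3P[/= /andP[/allP pf pw] /andP[pp app] /andP[_ ain]] /andP[py ay].
have [] := IH _ ay; first by rewrite /spine pw app ain.
move=> alt uniqD.
have fol u : u \in rcons (flat ps) y -> follows p u.
  rewrite mem_rcons inE => /orP[/eqP->//|/flatP[q /pf/andP[q1 q2]]].
  by case/orP=> /eqP->.
have pN u : u \in rcons (flat ps) y -> (p.1 != u) && (p.2 != u) by move/fol/follows_neq.
split.
  apply/and3P; split; last exact: alt.
    by rewrite pp; apply/allP=> u /fol/and3P[->].
  by apply/allP=> u /fol/and3P[_ _ /negbTE->].
apply/and3P; split=> //.
  rewrite inE negb_or (adj_neq pp) /=.
  by apply/negP=> /pN; rewrite eqxx.
by apply/negP=> /pN; rewrite eqxx andbF.
Qed.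

Lemma spine_filter (a : pred (T * T)) ps : spine ps -> spine (filter a ps).
Proof.
case/and3P=> pw /allP al /allP ain; apply/and3P; split.
- exact: subseq_pairwise (filter_subseq _ _) pw.
- by apply/allP=> p; rewrite mem_filter => /andP[_ /al].
- by apply/allP=> p; rewrite mem_filter => /andP[_ /ain].
Qed.

Lemma spine_catl ps qs : spine (ps ++ qs) -> spine ps.
Proof.
by case/and3P; rewrite pairwise_cat !all_cat => /and3P[_ pw _] /andP[al _] /andP[ain _];
  apply/and3P.
Qed.

Lemma size_flat ps : size (flat ps) = 2 * size ps.
Proof. by elim: ps => //= p ps; rewrite mulnS => ->. Qed.

Lemma pigeonhole4 (I : Type) (s : seq I) (f : I -> bool * bool) m :
  4 * m <= size s -> exists k, m <= size [seq i <- s | f i == k].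
Proof.
move=> ms; pose cnt k := size [seq i <- s | f i == k].
have tot : cnt (true, true) + cnt (true, false) + cnt (false, true) + cnt (false, false) = size s.
  rewrite /cnt {ms cnt}; elim: s => //= i s <-.
  by case: (f i) => [[] []]; rewrite !eqE /=; lia.
have [h1|h1] := leqP m (cnt (true, true)); first by exists (true, true).
have [h2|h2] := leqP m (cnt (true, false)); first by exists (true, false).
have [h3|h3] := leqP m (cnt (false, true)); first by exists (false, true).
exists (false, false); rewrite -/(cnt _); lia.
Qed.

Lemma alternating_rcons b D y : alternating e b (rcons D y) -> alternating e b D.
Proof.
elim: D b => //= u D IH b /andP[a /IH->]; rewrite andbT.
by move: a; rewrite all_rcons => /andP[].
Qed.

(** Four adjacency patterns of a vertex to a pair, and [n] pairs wanted with the same pattern. *)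
Definition gap := 4 * n.

(* Otherwise [z] has constant adjacency to the first and to the second vertices
   of [n] pairs of [ps2], and one of the alternating configurations appears. *)
Lemma locality ps1 ps2 z c d : spine (ps1 ++ ps2) -> gap <= size ps2 -> z \in S ->
  c \in tail_set (ps1 ++ ps2) -> d \in tail_set (ps1 ++ ps2) -> e z c -> ~~ e z d ->
  z \in tail_set ps1.
Proof.
move=> sp gp zS; rewrite !inE !all_cat => /and3P[cS c1 c2] /and3P[dS d1 d2] zc zd.
rewrite zS /=; apply/negPn/negP => /allPn[p pps1 pz].
have [spw spl spi] := and3P sp.
have pps2 : {in ps2, forall q, follows p q.1 /\ follows p q.2}.
  move=> q qps; move: spw; rewrite pairwise_cat => /and3P[/allrelP/(_ p q pps1 qps)].
  by move/andP.
have [k km] := @pigeonhole4 _ ps2 (fun q => (e z q.1, e z q.2)) n gp.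
set qs := [seq _ <- _ | _] in km.
have qsP q : q \in qs -> q \in ps2 /\ (e z q.1, e z q.2) = k.
  by rewrite mem_filter => /andP[/eqP].
have sps2 : spine ps2.
  by move: spw spl spi; rewrite pairwise_cat !all_cat => /and3P[_ _ pw] /andP[_ al] /andP[_ ai]; apply/and3P.
have sqs : spine qs by apply: spine_filter.
have zN u : u \in flat qs -> z != u.
  move=> /flatP[q /qsP[/pps2[q1 q2] _]] /orP[]/eqP->; apply: contraNneq pz => -> //.
have uS u : u \in flat qs -> u \in S.
  move=> /flatP[q /qsP[qps _]]; have [_ _ /allP/(_ q qps)/andP[s1 s2]] := and3P sps2.
  by case/orP=> /eqP->.
have fqs y : all (follows^~ y) ps2 -> all (follows^~ y) qs.
  by move=> /allP h; apply/allP=> q /qsP[/h].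
have zp1 : z != p.1.
  by apply: contraNneq zd => ->; move/allP: d1 => /(_ p pps1)/and3P[].
have zp2 : z != p.2.
  by apply: contraTneq zc => ->; move/allP: c1 => /(_ p pps1)/and3P[].
have [p1S p2S] : p.1 \in S /\ p.2 \in S.
  by move: spi; rewrite all_cat => /andP[/allP/(_ p pps1)/andP].
have folp u : u \in flat qs -> follows p u.
  by move=> /flatP[q /qsP[/pps2[q1 q2] _]] /orP[]/eqP->.
have row u : u \in flat qs -> e z u = k.1 \/ e z u = k.2.
  by move=> /flatP[q /qsP[_ <-]] /orP[]/eqP->; [left|right].
have [q [qs' qE]] : exists q qs', qs = q :: qs'.
  case: (qs) km => [|q qs' _]; last by exists q, qs'.
  by rewrite leqNgt (ltn_trans _ n_gt2).
have sz : n <= (size (flat qs)).-1 + 3.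
  by rewrite size_flat; apply: leq_trans km _; move: (size qs) => m; clear; lia.
(* Both phases of the alternation are needed; the one starting with [false] arises by dropping the
   first vertex. *)
have behD b y : y \in S -> all (follows^~ y) qs ->
    exists D : seq T, [/\ {subset D <= flat qs}, alternating e b (rcons D y), uniq (rcons D y),
                  n <= size D + 3 & {in rcons D y, forall u, e v u}].
  move=> yS /(flat_alternating sqs)[aD uD].
  have vD (D : seq T) : {subset D <= flat qs} -> {in rcons D y, forall u, e v u}.
    by move=> sD u; rewrite mem_rcons inE => /orP[/eqP->|/sD/uS]; apply: Sv.
  case: b.
    exists (flat qs); split=> //; last exact: vD.
    by apply: leq_trans sz _; rewrite leq_add2r leq_pred.
  have sub : {subset behead (flat qs) <= flat qs} by move=> u; apply: mem_behead.
  exists (behead (flat qs)); split=> //; last exact: vD.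
  - by move: aD; rewrite qE /= => /andP[].
  - by move: uD; rewrite qE /= => /andP[].
  - by rewrite size_behead.
have zuniq y (D : seq T) : z != y -> {subset D <= flat qs} -> uniq (rcons D y) -> uniq (z :: rcons D y).
  move=> zy sD uD; rewrite cons_uniq uD andbT mem_rcons inE negb_or zy.
  by apply/negP=> /sD/zN; rewrite eqxx.
apply: noC; case k1: k.1; case k2: k.2.
- have zd' : z != d.
    apply: contraNneq pz => ->; exact: (allP d1).
  have [D [sD aD uD nD vD]] := behD false d dS (fqs d d2).
  apply: (threshold_ends n_gt2 (b := true) (zuniq _ _ zd' sD uD)) => //.
  + exact: Sv.
  + exact: vD.
  + by move=> u /sD/row; rewrite k1 k2 => -[].
  + exact/negbTE.
(* Here [z] follows the selected pairs but not the earlier pair [p], so one of [p.1], [p.2] has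
   constant adjacency to the pairs and the opposite one to [z]. *)
- have fz : all (follows^~ z) qs.
    apply/allP=> w wq; have [_ wk] := qsP w wq.
    move: k1 k2; rewrite -wk /= => k1 k2; apply/and3P; split.
    + by rewrite gsym.
    + apply: zN; rewrite /flat; apply/flatten_mapP; exists w; rewrite // !inE eqxx orbT //.
    + by rewrite gsym k2.
  have [x [b [xS xp xz xu xf]]] : exists x b, [/\ x \in S, e x z = ~~ b, x != z,
      {in flat qs, forall u, x != u} & {in flat qs, forall u, e x u = b}].
    have [p1z|p1z] := boolP (e p.1 z); last first.
      exists p.1, true; split=> //; first exact/negbTE.
      - by rewrite eq_sym.
      - by move=> u /folp/follows_neq/andP[].
      - by move=> u /folp/and3P[].
    exists p.2, false; split=> //.
    - by move: pz; rewrite /follows p1z zp2 /= negbK.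
    - by rewrite eq_sym.
    - by move=> u /folp/follows_neq/andP[].
    - by move=> u /folp/and3P[_ _ /negbTE].
  have [D [sD aD uD nD vD]] := behD (~~ b) z zS fz.
  apply: (threshold_ends n_gt2 (x := x) (b := b) (D := D) (y := z)) => //.
  + rewrite cons_uniq uD andbT mem_rcons inE negb_or xz; apply/negP=> /sD/xu.
    by rewrite eqxx.
  + exact: Sv.
  + exact: vD.
  + by move=> u /sD/xf.
(* Here [z] sees exactly the second vertices, the reverse of a vertex that follows the pairs. *)
- have alt : alternating_row e z false (flat qs).
    have : {in qs, forall w, e z w.1 = false /\ e z w.2 = true}.
      by move=> w /qsP[_ wk]; rewrite -k1 -k2 -wk.
    elim: (qs) => //= w s IH ws; have [-> ->] := ws w (mem_head _ _).
    by rewrite IH // => w' w's; apply: ws; rewrite inE w's orbT.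
  have [aD uD] := flat_alternating sqs (fqs d d2).
  have zD : z \notin flat qs by apply/negP=> /zN; rewrite eqxx.
  have sz2 : n <= (size (flat qs)).-1 + 2.
    rewrite size_flat; apply: leq_trans km _; rewrite qE [size _]/=.
    by move: (size qs') => m; clear; lia.
  have {aD} aD := alternating_rcons aD.
  move: uD; rewrite rcons_uniq => /andP[_ uD].
  case fE: (flat qs) aD uD alt zD sz2 => [|w D] aD uD alt zD sz2.
    by move: fE; rewrite qE.
  exact: (reversed_row n_gt2 uD zD aD alt).
- have [D [sD aD uD nD vD]] := behD true c cS (fqs c c2).
  apply: (threshold_ends n_gt2 (b := false) (zuniq _ _ (adj_neq zc) sD uD)) => //.
  + exact: Sv.
  + exact: vD.
  + by move=> u /sD/row; rewrite k1 k2 => -[].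
Qed.

Definition mixes z (X : {set T}) := exists c d, [/\ c \in X, d \in X, e z c & ~~ e z d].

Definition mixers (X : {set T}) :=
  [set z in S | [exists c in X, exists d in X, e z c && ~~ e z d]].

Lemma mixersP z X : reflect (z \in S /\ mixes z X) (z \in mixers X).
Proof.
rewrite inE; apply: (iffP andP) => -[zS].
  move=> /exists_inP[c cX /exists_inP[d dX /andP[zc zd]]].
  by split=> //; exists c, d.
by case=> c [d [cX dX zc zd]]; split=> //; apply/exists_inP; exists c => //;
  apply/exists_inP; exists d; rewrite // zc.
Qed.

Fixpoint closure ps i := if i is j.+1 then closure ps j :|: mixers (closure ps j)
  else tail_set ps.

Lemma tail_set_cat ps qs : tail_set (ps ++ qs) \subset tail_set ps.
Proof. by apply/subsetP=> x; rewrite !inE all_cat => /and3P[-> ->]. Qed.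

(** By [locality], a vertex that mixes a set following a prefix of the spine still follows that
    prefix shortened by [gap] pairs. *)
Lemma closure_sub ps i : spine ps ->
  closure ps i \subset tail_set (take (size ps - i * gap) ps).
Proof.
move=> sp; elim: i => [|i IH]; first by rewrite mul0n subn0 take_size.
set k := size ps - i * gap in IH; rewrite mulSn addnC subnDA -/k.
have takeE : take k ps = take (k - gap) ps ++ drop (k - gap) (take k ps).
  by rewrite -[LHS](cat_take_drop (k - gap)) take_takel // leq_subr.
rewrite /= subUset; apply/andP; split.
  by apply: subset_trans IH _; rewrite takeE tail_set_cat.
apply/subsetP=> z /mixersP[zS [c [d [cX dX zc zd]]]].
have [kg|gk] := leqP k gap.
  by move: (kg); rewrite -subn_eq0 => /eqP->; rewrite take0 inE zS.
apply: (@locality _ (drop (k - gap) (take k ps)) z c d) => //.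
- rewrite -takeE; apply: (@spine_catl _ (drop k ps)); by rewrite cat_take_drop.
- by rewrite size_drop size_take_min (minn_idPl (leq_subr _ _)) subKn // ltnW.
- by rewrite -takeE; apply: (subsetP IH).
- by rewrite -takeE; apply: (subsetP IH).
Qed.

(* A vertex appearing at stage [i + 1] mixes the previous stage, hence separates
   some vertex appearing at stage [i] from the bulk; iterating gives a chain. *)
Lemma closure_chain ps i z : tail_set ps != set0 ->
  z \in closure ps i.+1 -> z \notin closure ps i ->
  exists ts D, [/\ size D = i.+1, chain e ts D, uniq D, head z D = z &
    {subset D <= closure ps i.+1} /\ {subset behead D <= closure ps i}].
Proof.
move=> /set0Pn[w0 w0R]; have w0c j : w0 \in closure ps j.
  by elim: j => //= j IH; rewrite inE IH.
elim: i z => [|i IH] z zX zN.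
  exists [:: false], [:: z]; split=> //; split=> // u; rewrite inE => /eqP-> //.
have /mixersP[zS [c [d [cX dX zc zd]]]] : z \in mixers (closure ps i.+1).
  by move: zX; rewrite [closure _ _.+2]/= in_setU (negbTE zN).
have hom w : w \in closure ps i -> e z w = e z w0.
  move=> wX; apply/eqP/negPn/negP => neq; case/negP: zN.
  rewrite /= in_setU; apply/orP; right; apply/mixersP; split=> //.
  by case zw: (e z w) neq; case zw0: (e z w0) => // _; [exists w, w0|exists w0, w]; split; rewrite ?zw ?zw0.
have [y yX zy] : exists2 y, y \in closure ps i.+1 & e z y = ~~ e z w0.
  case zw0: (e z w0); first by exists d; rewrite ?(negbTE zd).
  by exists c.
have yN : y \notin closure ps i.
  by apply/negP=> /hom; rewrite zy; case: (e z w0).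
have [ts [D [sD ch uD hD [DX DX']]]] := IH y yX yN.
case: D sD ch uD hD DX DX' => // y' D sD ch uD /= y'y DX DX'; rewrite {y'}y'y in sD ch uD DX DX'.
exists (e z w0 :: ts), [:: z, y & D]; split=> //.
- by rewrite -sD.
- apply/andP; split=> //; apply/allP=> u /=; rewrite inE => /orP[/eqP->|uD'].
    by rewrite eqxx addbT zy.
  rewrite hom ?DX' // (_ : (u == y) = false) ?addbF //.
  by apply: contraNF yN => /eqP<-; apply: DX'.
- by rewrite cons_uniq uD andbT; apply: contra zN => /DX.
- split=> [u|]; last exact: DX.
  by rewrite inE => /orP[/eqP->//|/DX uX]; rewrite /= in_setU uX.
Qed.

Definition modular_prime := forall X : {set T}, X \subset S -> 1 < #|X| -> X != S ->
  exists2 z, z \in S :\: X & mixes z X.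

Definition spine_bound := gap * ((zeros n + 3) * n.+1 + 2).

(** No first vertex of a pair follows its own pair, so by [closure_sub] the closure differs from [S]
    while pairs remain. Primeness then gives a vertex of the next stage, and [closure_chain] turns
    it into a chain long enough for [chain_has_cycle]. *)
Lemma spine_leq ps : modular_prime -> spine ps -> 1 < #|tail_set ps| ->
  size ps <= spine_bound.
Proof.
move=> prime sp R2; rewrite leqNgt; apply/negP=> big.
set K := (zeros n + 3) * n.+1 + 2 in big.
have K0 : K = K.-1.+1 by rewrite /K addn2.
have cS i : closure ps i \subset S.
  apply: subset_trans (closure_sub i sp) _.
  by apply/subsetP=> x; rewrite inE => /andP[].
have c1 i : 1 < #|closure ps i|.
  elim: i => // i IH; apply: leq_trans IH _; apply: subset_leq_card; exact: subsetUl.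
have cn : closure ps K.-1 != S.
  have : 0 < size ps - K.-1 * gap.
    by rewrite subn_gt0; apply: leq_ltn_trans big; rewrite mulnC leq_mul2l leq_pred orbT.
  have := closure_sub K.-1 sp.
  case: ps sp {R2 big cS c1} => [|p ps] sp; first by rewrite take0 => _; rewrite /= sub0n.
  case: (_ - _) => // k /subsetP sub _; apply/eqP=> cE.
  have pS : p.1 \in S by move: sp => /and3P[_ _ /andP[/andP[]]].
  rewrite -cE in pS; move: (sub _ pS); rewrite inE => /andP[_ /andP[/follows_neq]].
  by rewrite eqxx.
have [z] := prime _ (cS K.-1) (c1 _) cn; rewrite inE => /andP[zN zS] mz.
have zX : z \in closure ps K.-1.+1 by rewrite /= in_setU; apply/orP; right; apply/mixersP.
have R0 : tail_set ps != set0 by rewrite -card_gt0 ltnW.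
have [ts [D [sD ch uD _ [DX _]]]] := closure_chain R0 zX zN.
apply: noC; apply: (chain_has_cycle n_gt2 (v := v) uD _ ch).
  by move=> u /DX/(subsetP (cS _)); apply: Sv.
by rewrite sD -K0.
Qed.
End Spine.

(** * Complete pairs in modular primes *)

Section Complement.
Variables (T : finType) (e : graph T).
Implicit Types (x y : T).

Definition co_rel : rel T := fun x y => (x != y) && ~~ e x y.

Fact co_sym : symmetric co_rel.
Proof. by move=> x y; rewrite /co_rel eq_sym gsym. Qed.

Fact co_irr : irreflexive co_rel.
Proof. by move=> x; rewrite /co_rel eqxx. Qed.

Definition co := Graph co_sym co_irr.
End Complement.

(** * Cliques and weighted clique numbers *)

Section WeightedCliques.
Variables (T : finType) (e : graph T).
Implicit Types (w : T -> nat) (A B K L U : {set T}).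

Definition complete A B := {in A & B, forall x y, e x y}.

Definition clq K := [forall x in K, forall y in K, (x != y) ==> e x y].

Lemma clqP K : reflect {in K &, forall x y, x != y -> e x y} (clq K).
Proof.
apply: (iffP forall_inP) => [h x y xK yK|h x xK].
  by move/forall_inP: (h x xK) => /(_ y yK)/implyP.
by apply/forall_inP=> y yK; apply/implyP; apply: h.
Qed.

Lemma clqS K L : K \subset L -> clq L -> clq K.
Proof. by move=> /subsetP KL /clqP Lc; apply/clqP=> x y /KL xL /KL; apply: Lc. Qed.

Lemma clqU K L : clq K -> clq L -> complete K L -> clq (K :|: L).
Proof.
move=> /clqP Kc /clqP Lc KL; apply/clqP=> x y; rewrite !inE => /orP[xK|xL] /orP[yK|yL] xy.
- exact: Kc.
- exact: KL.
- by rewrite gsym KL.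
- exact: Lc.
Qed.

Definition weight w K := \sum_(x in K) w x.

Definition omega w A := \max_(K : {set T} | (K \subset A) && clq K) weight w K.

Lemma omega_geq w K A : K \subset A -> clq K -> weight w K <= omega w A.
Proof. by move=> KA Kc; apply: leq_bigmax_cond; rewrite KA Kc. Qed.

Lemma omega_leq w A k : (forall K, K \subset A -> clq K -> weight w K <= k) -> omega w A <= k.
Proof. by move=> h; apply/bigmax_leqP=> K /andP[]; apply: h. Qed.

Lemma omegaP w A : exists K, [/\ K \subset A, clq K & weight w K = omega w A].
Proof.
have [|K /andP[KA Kc] KE] := eq_bigmax_cond (weight w)
  (A := fun K => (K \subset A) && clq K); last by exists K; split=> //; apply: esym KE.
apply/card_gt0P; exists set0; rewrite -topredE /= sub0set /=.
by apply/clqP=> x; rewrite inE.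
Qed.

Lemma weightU w K L : complete K L -> weight w (K :|: L) = weight w K + weight w L.
Proof.
move=> KL; have KL0 : [disjoint K & L].
  rewrite disjoint_subset; apply/subsetP=> x xK; rewrite inE.
  by apply/negP=> /(KL x x xK); rewrite girr.
by rewrite /weight -bigU //; apply: eq_bigl => x; rewrite !inE.
Qed.

Lemma omegaS w A B : A \subset B -> omega w A <= omega w B.
Proof. by move=> AB; apply: omega_leq => K KA; apply/omega_geq/(subset_trans KA). Qed.

Lemma omega_complete w A B U : A \subset U -> B \subset U -> complete A B ->
  omega w A + omega w B <= omega w U.
Proof.
move=> AU BU AB; have [K [KA Kc <-]] := omegaP w A; have [L [LB Lc <-]] := omegaP w B.
have KL : complete K L by move=> x y /(subsetP KA) xA /(subsetP LB); apply: AB.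
rewrite -weightU //; apply: omega_geq; last exact: clqU.
by rewrite subUset (subset_trans KA AU) (subset_trans LB BU).
Qed.

Lemma weight1 w x : weight w [set x] = w x.
Proof. exact: big_set1. Qed.

Lemma clq1 x : clq [set x].
Proof. by apply/clqP=> y z /set1P-> /set1P->; rewrite eqxx. Qed.

Lemma omega_geq1 w A x : x \in A -> w x <= omega w A.
Proof. by move=> xA; rewrite -[w x]weight1 omega_geq ?sub1set ?clq1. Qed.
End WeightedCliques.

(** * Complete pairs and the polynomial bound for primes *)

Section CompletePairs.
Variables (T : finType) (e : graph T) (n : nat) (v : T) (S : {set T}).
Hypothesis n_gt2 : 2 < n.
Hypothesis noC : ~ has_cycle n e.
Hypothesis Sv : {in S, forall x, e v x}.
Implicit Types (A B C U W Z : {set T}) (x y z : T).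
Local Notation chi := (chi e).

Definition plen := (3 * n).+1.

Lemma short_path s : {subset s <= S} -> ipath e s -> size s <= plen.
Proof.
move=> sS p; rewrite leqNgt; apply/negP=> big; apply: noC; apply: (fan n_gt2 (u := v) p).
  by apply/negP=> /sS/Sv; rewrite girr.
have -> : count (e v) s = size s by apply/eqP; rewrite -all_count; apply/allP=> x /sS/Sv.
by [].
Qed.

Lemma short_copath s : {subset s <= S} -> ipath (co e) s -> size s <= plen.
Proof.
move=> sS p; rewrite leqNgt; apply/negP=> big; apply: noC.
apply: (@has_cycle_lc _ _ _ v); apply: (fan n_gt2 (u := v) (s := s)).
- rewrite -(eq_ipath (e := co e)) // => x y /sS/Sv vx /sS/Sv vy.
  rewrite [LHS]/= /co_rel; have [->|xy] := eqVneq x y; last by rewrite lc_flip.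
  by rewrite /= girr.
- by apply/negP=> /sS/Sv; rewrite girr.
- have -> : count (lc e v v) s = size s; last by [].
  by apply/eqP; rewrite -all_count; apply/allP=> x /sS/Sv; rewrite lc_self.
Qed.

Definition unsplit theta U := forall A B, A \subset U -> B \subset U -> complete e A B ->
  (chi A < theta) || (chi B < theta).

(** A set closed in the complement is complete to the rest, so by [unsplit] the rest stays below
    [theta]. If it also split into two parts below [theta], the whole would be below [3 * theta]. *)
Lemma co_component theta U Z : 0 < theta -> unsplit theta U -> Z \subset U ->
  3 * theta <= chi Z -> exists C,
  [/\ closed_in (co e) Z C, connected (co e) C, C != set0 & chi Z <= chi C + theta].
Proof.
move=> t0 uns ZU Zt.
have cmpl Y C : closed_in (co e) Y C -> complete e C (Y :\: C).
  case=> _ nC x y xC yY; have := nC x y xC yY; rewrite /= /co_rel negb_and !negbK.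
  by case/orP=> // /eqP xy; move: yY; rewrite -xy inE xC.
have [||C [Ccl cC PC]] := @closed_connected T (co e) Z (fun X => theta <= chi X).
- by apply: leq_trans Zt; rewrite leq_pmull.
- move=> C A Ccl PC Acl; apply/negPn/negP; rewrite negb_or -!ltnNge => /andP[At CAt].
  have CU : C \subset U by apply: subset_trans ZU; case: Ccl.
  have := uns C (Z :\: C) CU (subset_trans (subsetDl _ _) ZU) (cmpl _ _ Ccl).
  rewrite ltnNge PC /= => ZC.
  have := chiD e Z C; have := chiD e C A.
  have : chi (Z :&: C) <= chi C by apply/chiS/subsetIr.
  have : chi (C :&: A) <= chi A by apply/chiS/subsetIr.
  move: Zt At CAt ZC; move: (chi Z) (chi C) (chi A) (chi (Z :\: C)) (chi (C :\: A)).
  by move: (chi (_ :&: _)) (chi (_ :&: _)); clear; lia.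
have CU : C \subset U by apply: subset_trans ZU; case: Ccl.
exists C; split=> //; first by rewrite -(chi_gt0 e); apply: leq_trans PC.
have := uns C (Z :\: C) CU (subset_trans (subsetDl _ _) ZU) (cmpl _ _ Ccl).
rewrite ltnNge PC /= => ZC; apply: leq_trans (chiD _ _ C) _.
by rewrite addnC leq_add //; [apply/chiS/subsetIr | apply: ltnW].
Qed.

(** In [mixing_vertex] the Gyarfas path lives in a part with half of chi(W). One quarter of chi(W)
    pays for [plen] neighbourhoods ([kfac]), another for at most [plen + 6] losses of [theta]
    ([qfac]). *)
Definition kfac := 4 * plen.
Definition qfac := 4 * (plen + 6).

Lemma kfac_qfac : kfac < qfac.
Proof. by rewrite ltn_pmul2l // -addn1 leq_add2l. Qed.

(** Otherwise each vertex of [W] has a neighbourhood or a non-neighbourhood of small chromatic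
    number in [W]. One kind carries half of chi(W), and Gyarfas finds there a path or a co-path with
    more than [plen] vertices. *)
Lemma mixing_vertex theta U W : 0 < theta -> U \subset S -> unsplit theta U ->
  W \subset U -> qfac * theta <= chi W ->
  exists x, [/\ x \in W, chi W <= kfac * chi (W :&: nbr e x) &
                chi W <= kfac * chi (W :\: nbr e x)].
Proof.
move=> t0 US uns WU Wt; have WS := subset_trans WU US.
have [/existsP[x /and3P[xW x1 x2]]|nx] := boolP [exists x, [&& x \in W,
  chi W <= kfac * chi (W :&: nbr e x) & chi W <= kfac * chi (W :\: nbr e x)]].
  by exists x.
exfalso; have {nx} mix x : x \in W -> ~~ (chi W <= kfac * chi (W :&: nbr e x)) ||
    ~~ (chi W <= kfac * chi (W :\: nbr e x)).
  by move=> xW; move: nx; rewrite negb_exists => /forallP/(_ x); rewrite xW /= negb_and.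
pose L := [set x in W | ~~ (chi W <= kfac * chi (W :&: nbr e x))].
pose r := chi W %/ kfac; have k0 : 0 < kfac by [].
have rP a : ~~ (chi W <= kfac * a) -> a <= r.
  by rewrite -ltnNge /r leq_divRL // mulnC => /ltnW.
have rW : 4 * (plen * r) <= chi W.
  by rewrite mulnA -/kfac mulnC /r leq_divM.
have LW : L \subset W by apply/subsetP=> x; rewrite inE => /andP[].
have LD : chi W <= chi (W :\: L) + chi L.
  by apply: leq_trans (chiD _ _ L) _; rewrite leq_add2l; apply/chiS/subsetIr.
move: Wt; rewrite /qfac mulnDr mulnDl -!mulnA => Wt.
have [big|small] := leqP (chi W) (2 * chi L).
  have [||s [ss sL p]] := @long_path T e L r plen.
  - move=> x; rewrite inE => /andP[_ /rP]; apply: leq_trans; apply/chiS; exact: setSI.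
  - move: rW big t0 Wt; move: (plen * r) (plen * theta) (chi W) (chi L); clear; lia.
  have := short_path (fun x xs => subsetP WS x (subsetP LW x (sL x xs))) p.
  by rewrite ss ltnn.
have DW : W :\: L \subset W by apply: subsetDl.
have [||||s [ss sD p]] := @gyarfas_path T (co e) (W :\: L) chi r theta (3 * theta) plen.
- move=> x; rewrite !inE => /andP[xL xW] C CD.
  have xr : chi (W :\: nbr e x) <= r by apply: rP; move: (mix x xW) xL; rewrite xW /=; case: (_ <= _).
  apply: leq_trans (chiD _ _ (nbr (co e) x)) _; rewrite leq_add2l.
  apply: leq_trans xr; apply: chiS; apply/subsetP=> y; rewrite !inE /= /co_rel.
  by case/andP=> /(subsetP CD); rewrite !inE => /andP[_ ->] /andP[_ ->].
- by move=> Z ZD; apply: co_component uns _ => //; apply: subset_trans WU; apply: subset_trans DW.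
- by move=> C x; apply: chiD1.
- rewrite mulnDr; move: rW small t0 Wt LD.
  move: (plen * r) (plen * theta) (chi W) (chi L) (chi (W :\: L)); clear; lia.
have := short_copath (fun x xs => subsetP WS x (subsetP DW x (sD x xs))) p.
by rewrite ss ltnn.
Qed.

(** Two mixing steps per pair, and a factor 2 for discarding [b] itself. *)
Definition k2 := 2 * kfac * kfac.

Lemma build_spine theta U : 0 < theta -> U \subset S -> unsplit theta U ->
  forall i W, W \subset U -> qfac * theta * k2 ^ i <= chi W ->
  exists ps W', [/\ size ps = i, spine e S ps,
    all (fun p => (p.1 \in W) && (p.2 \in W)) ps, W' \subset W &
    {in W', forall u, all (follows e ^~ u) ps} /\ qfac * theta <= chi W'].
Proof.
move=> t0 US uns; elim=> [|i IH] W WU Wt.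
  by exists [::], W; split=> //; split=> //; rewrite muln1 in Wt.
have k0 : 0 < kfac by [].
have Wq : qfac * theta * kfac <= chi W.
  apply: leq_trans Wt; rewrite leq_mul2l expnS /k2; apply/orP; right.
  have k20 : 0 < k2 ^ i by rewrite expn_gt0 /k2 !muln_gt0.
  by rewrite [_ * kfac * _]mulnAC leq_pmull // !muln_gt0 k20.
have [|a [aW aN _]] := mixing_vertex t0 US uns WU.
  by apply: leq_trans Wq; rewrite leq_pmulr.
set W1 := W :&: nbr e a in aN.
have W1W : W1 \subset W by apply: subsetIl.
have W1t : qfac * theta <= chi W1.
  by rewrite -(leq_pmul2r k0) [chi W1 * _]mulnC; apply: leq_trans aN.
have [b [bW1 _ bN]] := mixing_vertex t0 US uns (subset_trans W1W WU) W1t.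
set W2 := (W1 :\: nbr e b) :\ b.
have W2W : W2 \subset W.
  by apply: subset_trans W1W; apply: subset_trans (subsetDl _ _) (subsetDl _ _).
have W2t : chi W <= k2 * chi W2.
  have W2b := chiD1 e (W1 :\: nbr e b) b; rewrite -/W2 in W2b.
  have m1 : 1 < chi (W1 :\: nbr e b).
    rewrite -(@ltn_pmul2l kfac) // muln1; apply: leq_trans bN; apply: leq_trans W1t.
    exact: leq_trans kfac_qfac (leq_pmulr _ t0).
  have m2 : chi (W1 :\: nbr e b) <= 2 * chi W2.
    by move: W2b m1; move: (chi _) (chi _); clear; lia.
  apply: leq_trans aN _; apply: (@leq_trans (kfac * (kfac * (2 * chi W2)))).
    by rewrite leq_mul2l (leq_trans bN) ?orbT // leq_mul2l m2 orbT.
  by rewrite /k2; move: kfac (chi W2) => k m; rewrite [k * (2 * m)]mulnCA mulnCA !mulnA.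
have [|ps [W' [ss sp psW W'W [fol W't]]]] := IH W2 (subset_trans W2W WU).
  rewrite -(@leq_pmul2l k2) ?muln_gt0 //; apply: leq_trans W2t.
  by rewrite mulnCA -expnS.
have folab u : u \in W2 -> follows e (a, b) u.
  by rewrite !inE => /and3P[ub bu /andP[_ au]]; apply/and3P.
have aS := subsetP (subset_trans WU US) a aW.
have bW := subsetP W1W b bW1; have bS := subsetP (subset_trans WU US) b bW.
exists ((a, b) :: ps), W'; split.
- by rewrite /= ss.
- move: sp => /and3P[s1 s2 s3]; apply/and3P; split=> /=; last by rewrite aS bS.
    rewrite s1 andbT; apply/allP=> p /(allP psW)/andP[p1 p2].
    by rewrite !folab.
  by rewrite s2 andbT; move: bW1; rewrite !inE => /andP[].
- rewrite /= aW bW /=; apply/allP=> p /(allP psW)/andP[p1 p2].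
  by rewrite !(subsetP W2W).
- exact: subset_trans W'W W2W.
- split=> // u uW'; rewrite /= fol // folab //; exact: (subsetP W'W).
Qed.

Definition pair_factor := 2 * (qfac * k2 ^ (spine_bound n).+1).

Hypothesis Sprime : modular_prime e S.

Lemma complete_pair U : U \subset S -> 1 < chi U -> exists A B,
  [/\ A \subset U, B \subset U, complete e A B,
      chi U <= pair_factor * chi A & chi U <= pair_factor * chi B].
Proof.
move=> US U1; set c := pair_factor.
have c0 : 0 < c by rewrite !muln_gt0 expn_gt0 !muln_gt0.
(* Below [c], the two ends of any edge are large enough. Above it, rounding [theta] up costs at most
   the factor 2 in [pair_factor]. *)
have [Uc|cU] := leqP (chi U) c.
  have [/existsP[x /existsP[y /and3P[xU yU xy]]]|nE] :=
      boolP [exists x, exists y, [&& x \in U, y \in U & e x y]].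
    have gt1 z : 0 < chi [set z] by rewrite chi_gt0; apply/set0Pn; exists z; rewrite inE.
    exists [set x], [set y]; rewrite !sub1set; split=> //.
    - by move=> a b /set1P-> /set1P->.
    - by apply: leq_trans Uc _; rewrite leq_pmulr.
    - by apply: leq_trans Uc _; rewrite leq_pmulr.
  move: U1; rewrite ltnNge; case/negP; apply: chi_indep => x y xU yU.
  by move: nE; rewrite negb_exists => /forallP/(_ x); rewrite negb_exists => /forallP/(_ y); rewrite xU yU.
pose theta := (chi U %/ c).+1.
have Ut : chi U < c * theta by rewrite mulnC ltn_ceil.
have tU : c * theta <= 2 * chi U.
  rewrite mulnS mul2n -addnn leq_add ?(ltnW cU) // mulnC; exact: leq_divM.
pose good A B := [&& A \subset U, B \subset U, [forall x in A, forall y in B, e x y],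
  theta <= chi A & theta <= chi B].
have [/existsP[A /existsP[B /and5P[AU BU /forall_inP AB At Bt]]]|nG] :=
    boolP [exists A, exists B, good A B].
  exists A, B; split=> //.
  - by move=> x y xA yB; move/forall_inP: (AB x xA); apply.
  - by apply: ltnW; apply: leq_trans Ut _; rewrite leq_mul2l At orbT.
  - by apply: ltnW; apply: leq_trans Ut _; rewrite leq_mul2l Bt orbT.
exfalso; have uns : unsplit theta U.
  move=> A B AU BU AB; apply: contraR nG; rewrite negb_or -!leqNgt => /andP[At Bt].
  apply/existsP; exists A; apply/existsP; exists B; apply/and5P; split=> //.
  by apply/forall_inP=> x xA; apply/forall_inP=> y yB; apply: AB.
have [|ps [W [ss sp _ WU [fol Wt]]]] := @build_spine theta U isT US uns (spine_bound n).+1 U (subxx _).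
  rewrite -(@leq_pmul2l 2) //; apply: leq_trans tU.
  by rewrite [X in 2 * X]mulnAC mulnA.
have R2 : 1 < #|tail_set e S ps|.
  have W1 : 1 < chi W.
    apply: leq_trans Wt; apply: (@leq_trans qfac); last by rewrite leq_pmulr.
    by apply: leq_trans kfac_qfac.
  have WR : W \subset tail_set e S ps.
    by apply/subsetP=> u uW; rewrite inE fol // andbT; apply/(subsetP US)/(subsetP WU).
  apply: leq_trans (subset_leq_card WR); rewrite ltnNge; apply/negP=> /card_le1_eqP W1'.
  move: W1; rewrite ltnNge; case/negP; apply: chi_indep => x y xW yW.
  by rewrite (W1' x y xW yW) girr.
have := spine_leq n_gt2 noC Sv Sprime sp R2.
by rewrite ss ltnn.
Qed.

Definition prime_degree := pair_factor.

Local Notation omega := (omega e (fun=> 1)).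

(** Of two parts complete to each other, one has at most half of omega(U). Losing the factor
    [pair_factor] is compensated by this halving, since the exponent is the same number c and c <=
    2^c. *)
Lemma chi_prime U : U \subset S -> chi U <= omega U ^ prime_degree.
Proof.
have [m] := ubnP (omega U); elim: m U => // m IH U Um US.
have [U1|U1] := leqP (chi U) 1.
  have [->|/set0Pn[x xU]] := eqVneq U set0; first by rewrite chi0.
  by apply: leq_trans U1 _; rewrite expn_gt0 (@omega_geq1 _ e (fun=> 1) U x).
have [A [B [AU BU AB UA UB]]] := complete_pair US U1.
wlog AlB : A B AU BU AB UA UB / omega A <= omega B.
  move=> H; have [l|/ltnW l] := leqP (omega A) (omega B); first exact: (H A B).
  by apply: (H B A) => // x y xB yA; rewrite gsym; apply: AB.
have nz C : chi U <= pair_factor * chi C -> C != set0.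
  by move=> UC; apply: contraTneq U1 => C0; rewrite C0 chi0 muln0 leqn0 in UC; rewrite (eqP UC).
have ABU := omega_complete (fun=> 1) AU BU AB.
have B0 : 0 < omega B.
  by have /set0Pn[x xB] := nz B UB; apply: (@omega_geq1 _ e (fun=> 1) B x).
have AU2 : 2 * omega A <= omega U.
  by apply: leq_trans ABU; rewrite mul2n -addnn leq_add2l.
have Am : omega A < m.
  rewrite -ltnS; apply: leq_ltn_trans Um; apply: leq_trans ABU.
  by rewrite -addn1 leq_add2l.
apply: leq_trans UA _; apply: leq_trans (leq_mul (leqnn _) (IH A Am (subset_trans AU US))) _.
apply: (@leq_trans ((2 * omega A) ^ prime_degree)); last by rewrite leq_exp2r // !muln_gt0 expn_gt0 !muln_gt0.
by rewrite expnMn leq_mul2r; apply/orP; right; apply: ltnW; apply: ltn_expl.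
Qed.
End CompletePairs.

(** * Set colourings and substitution *)

Section PolynomialBudget.
Variable d : nat.

(* Vertices of weight at most [k / 2] are grouped by the [i] with
   [2 ^ i <= w < 2 ^ i.+1]; a class is coloured with [(k %/ 2 ^ i) ^ d] blocks of
   [class_size k i ^ cexp] colours.  The exponent makes the classes up to [i] fit
   into the top [k ^ cexp - (k - 2 ^ i) ^ cexp] colours, which are out of reach
   of the heavier neighbours of a vertex of class [i]. *)
Definition cexp := 4 * d + 5.

Definition class_size k i := minn (2 ^ i.+1) k./2.

Definition class_cost k i := (k %/ 2 ^ i) ^ d * class_size k i ^ cexp.

Definition budget k i := \sum_(j < i) class_cost k j.

Lemma leq_expn m n c : m <= n -> m ^ c <= n ^ c.
Proof. by case: c => // c mn; rewrite leq_exp2r. Qed.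

Lemma expn_gap k y c : y <= k -> y * k ^ c + (k - y) ^ c.+1 <= k ^ c.+1.
Proof.
move=> yk; rewrite [X in _ <= X]expnS -[X in _ <= X * _](subnKC yk) mulnDl leq_add2l.
by rewrite expnS leq_mul2l leq_expn ?orbT // leq_subr.
Qed.

(** With y = 2^i and a = k - y, the bounds 3m <= 2a and 3qm <= 8a give q m^4 <= a^4 and 4 m^4 <=
    a^4, both because 64 < 81. With m <= 4y the cost is at most y a^(4d+4), to which [expn_gap]
    applies. The fourth powers account for the 4 in [cexp]. *)
Lemma class_cost_gap k i : 2 * 2 ^ i.+1 <= k ->
  class_cost k i.+1 + (k - 2 ^ i.+1) ^ cexp <= (k - 2 ^ i) ^ cexp.
Proof.
rewrite /class_cost /class_size [2 ^ i.+2]expnS expnS mulnA => yk.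
have := leq_divM k (2 * 2 ^ i).
set q := k %/ _; set m := minn _ _; set y := 2 ^ i in yk q m *; set a := k - y => qk.
have my : m <= 4 * y by apply: geq_minl.
have mk : 2 * m <= k by rewrite /m; clear; lia.
have y0 : 0 < y by rewrite expn_gt0.
have ak : 3 * k <= 4 * a by rewrite /a; move: yk; clear; lia.
have qm : 3 * (q * m) <= 8 * a.
  apply: (@leq_trans (3 * (2 * k))); last by move: ak; clear; lia.
  rewrite leq_mul2l; apply: (@leq_trans (q * (4 * y))); first by rewrite leq_mul2l my orbT.
  by move: qk; rewrite [q * (2 * y)]mulnCA [q * (4 * y)]mulnCA; move: (q * y); clear; lia.
have ma : 3 * m <= 2 * a by move: ak mk; clear; lia.
have -> : k - 2 * y = a - y by rewrite /a mul2n -addnn subnDA.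
have ya : y <= a by rewrite /a; move: yk; clear; lia.
rewrite /cexp addnS; apply: leq_trans (expn_gap _ ya); rewrite leq_add2r.
have m4 : 4 * m ^ 4 <= a ^ 4.
  have h : (3 * m) ^ 4 <= (2 * a) ^ 4 by apply: leq_expn.
  move: h; rewrite !expnMn (_ : 3 ^ 4 = 81) // (_ : 2 ^ 4 = 16) //.
  by move: (m ^ 4) (a ^ 4); clear; lia.
have qm4 : q * m ^ 4 <= a ^ 4.
  have h : (3 * (q * m)) * (3 * m) ^ 3 <= (8 * a) * (2 * a) ^ 3.
    by apply: leq_mul => //; apply: leq_expn.
  move: h; rewrite !expnMn (_ : 3 ^ 3 = 27) // (_ : 2 ^ 3 = 8) //.
  rewrite [_ * (27 * _)]mulnACA [_ * (8 * _)]mulnACA -expnS -[q * m * _]mulnA -expnS.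
  by move: (q * m ^ 4) (a ^ 4); clear; lia.
rewrite [m ^ _]expnS [m ^ _]expnD [a ^ _]expnD [m ^ (_ * _)]expnM [a ^ (_ * _)]expnM.
apply: (@leq_trans ((q * m ^ 4) ^ d * (m * m ^ 4))).
  by rewrite expnMn -mulnA [m * (_ * _)]mulnCA.
apply: (@leq_trans ((a ^ 4) ^ d * (4 * y * m ^ 4))).
  by apply: leq_mul; [apply: leq_expn | rewrite leq_mul2r my orbT].
rewrite -mulnA [4 * _]mulnCA mulnCA leq_mul2l leq_mul2l m4.
by rewrite !orbT.
Qed.

Lemma budget_leq k i : 2 * 2 ^ i <= k ->
  budget k i.+1 + (k - 2 ^ i) ^ cexp <= k ^ cexp.
Proof.
elim: i => [|i IH] ik.
  rewrite /budget big_ord_recl big_ord0 addn0 /class_cost /class_size divn1.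
  set m := minn _ _; have m2 : m <= 2 by apply: geq_minl.
  have mk : 2 * m <= k by rewrite /m; clear; lia.
  rewrite /cexp addnS; apply: (leq_trans _ (@expn_gap k (2 ^ 0) _ _)); last by apply: leq_trans ik.
  rewrite leq_add2r expn0 mul1n.
  have m3 : m ^ 4 <= k ^ 3.
    apply: leq_trans (leq_expn 3 mk); rewrite expnS expnMn leq_mul2r.
    by rewrite (leq_trans m2) ?orbT.
  have m5 : m ^ 5 <= k ^ 4.
    apply: leq_trans (leq_expn 4 mk); rewrite expnS expnMn leq_mul2r.
    by rewrite (leq_trans m2) ?orbT.
  rewrite -addnS [m ^ _]expnD [m ^ (_ * _)]expnM mulnA -expnMn expnD [k ^ (_ * _)]expnM.
  apply: leq_mul => //; apply: leq_expn; rewrite expnS leq_mul2l m3 orbT //.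
rewrite /budget big_ord_recr /= -addnA.
have := class_cost_gap ik; rewrite -(leq_add2l (budget k i.+1)) => h.
apply: leq_trans h _; apply: IH; apply: leq_trans ik; rewrite leq_mul2l /=.
by rewrite leq_exp2l.
Qed.

Lemma budgetS k i j : i <= j -> budget k i <= budget k j.
Proof.
move/subnKC <-; elim: (j - i) => [|m IH]; first by rewrite addn0.
by rewrite addnS /budget big_ord_recr /= (leq_trans IH) // leq_addr.
Qed.

End PolynomialBudget.

(** * Colouring by sets, for primes and under substitution *)

Section SetColorings.
Variables (T : finType) (e : graph T) (n : nat) (v : T).
Hypothesis n_gt2 : 2 < n.
Hypothesis noC : ~ has_cycle n e.
Implicit Types (S X : {set T}) (w : T -> nat) (x y z : T) (phi : T -> seq nat).
Local Notation omega := (omega e).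

Definition degree := cexp (prime_degree n).

Definition set_coloring S w N phi :=
  {in S, forall x, [/\ uniq (phi x), size (phi x) = w x ^ degree & {in phi x, forall i, i < N}]} /\
  {in S &, forall x y, e x y -> {in phi x, forall i, i \notin phi y}}.

Definition homogeneous S X := {in S :\: X & X &, forall z x y, e z x = e z y}.

Lemma prime_or_homogeneous S :
  modular_prime e S \/ exists X, [/\ X \subset S, 1 < #|X|, X != S & homogeneous S X].
Proof.
have [/forallP pS|] := boolP [forall X : {set T}, [&& X \subset S, 1 < #|X| & X != S] ==>
    (mixers e S X :\: X != set0)].
  left=> X XS X1 XS'; have := pS X; rewrite XS X1 XS' /= => /set0Pn[z].
  by rewrite inE => /andP[zX /mixersP[zS zm]]; exists z; rewrite // inE zX.
rewrite negb_forall => /existsP[X]; rewrite negb_imply => /andP[/and3P[XS X1 X2]].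
rewrite negbK => /eqP mX; right; exists X; split=> // z x y zSX xX yX.
move: zSX; rewrite inE => /andP[zX zS].
have nm c d : c \in X -> d \in X -> e z c -> e z d.
  move=> cX dX zc; apply/negPn/negP => zd.
  suff : z \in mixers e S X :\: X by rewrite mX inE.
  by rewrite inE zX; apply/mixersP; split=> //; exists c, d.
by apply/idP/idP; apply: nm.
Qed.

(** A clique through the contracted vertex trades it for a heaviest clique of [X], which homogeneity
    makes complete to the rest. *)
Lemma omega_contract S X w x : X \subset S -> x \in X -> homogeneous S X ->
  omega (fun y => if y == x then omega w X else w y) (x |: (S :\: X)) <= omega w S.
Proof.
move=> XS xX hom; set w' := fun y => _; apply: omega_leq => K KS Kc.
have w'E (L : {set T}) : x \notin L -> weight w' L = weight w L.
  move=> xL; apply: eq_bigr => y yL; rewrite /w'; case: eqP => // yx.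
  by move: xL; rewrite -yx yL.
have KD : K :\ x \subset S :\: X.
  apply/subsetP=> y; rewrite in_setD1 => /andP[yx /(subsetP KS)].
  by rewrite in_setU1 (negbTE yx).
have KDS : K :\ x \subset S by apply: subset_trans KD (subsetDl _ _).
have [xK|xK] := boolP (x \in K); last first.
  rewrite w'E //; apply: omega_geq => //; apply: subset_trans KDS.
  by apply/subsetP=> y yK; rewrite !inE yK andbT; apply: contraNneq xK => <-.
have [L [LX Lc Lw]] := omegaP e w X.
have KL : complete e (K :\ x) L.
  move=> y z yK zL; rewrite (hom y z x) ?(subsetP KD) ?(subsetP LX z zL) //.
  by move: yK; rewrite !inE => /andP[yx yK]; move/clqP: Kc; apply.
have -> : weight w' K = weight w (K :\ x :|: L).
  rewrite (weightU _ KL) -[in RHS]w'E ?inE ?eqxx // /weight (big_setD1 x xK) /= addnC.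
  by rewrite {2}/w' eqxx -Lw.
apply: omega_geq; first by rewrite subUset KDS (subset_trans LX XS).
by apply: clqU => //; apply: clqS Kc; apply: subsetDl.
Qed.

(** The palette of [X] has as many colours as [psi] gives to [x], so the colours of [phi] are read
    as positions in the list [psi x]. *)
Lemma set_coloring_substitute S X w x : X \subset S -> x \in X -> homogeneous S X ->
  (exists phi, set_coloring X w (omega w X ^ degree) phi) ->
  (forall w', exists phi, set_coloring (x |: (S :\: X)) w' (omega w' (x |: (S :\: X)) ^ degree) phi) ->
  exists phi, set_coloring S w (omega w S ^ degree) phi.
Proof.
move=> XS xX hom [phi [phiS phiC]].
pose w' y := if y == x then omega w X else w y.
move/(_ w') => [psi [psiS psiC]].
have le : omega w' (x |: (S :\: X)) ^ degree <= omega w S ^ degree.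
  by apply: leq_expn; apply: omega_contract.
have [pu ps pN] := psiS x (setU11 _ _); rewrite /w' eqxx in ps.
have inD y : y \in S -> y \notin X -> y \in x |: (S :\: X).
  by move=> yS yX; rewrite !inE yS yX orbT.
pose chi y := if y \in X then [seq nth 0 (psi x) i | i <- phi y] else psi y.
have chiX y : y \in X -> {subset chi y <= psi x}.
  move=> yX i; rewrite /chi yX => /mapP[j jp ->]; apply: mem_nth; rewrite ps.
  by have [_ _] := phiS y yX; apply.
exists chi; split=> [y yS|y z yS zS yz i].
  have [yX|yX] := boolP (y \in X); last first.
    have [u s N] := psiS y (inD y yS yX); rewrite /chi (negbTE yX); split=> //.
      by rewrite s /w'; case: eqP => // yx; rewrite yx xX in yX.
    by move=> i /N il; apply: leq_trans le.
  have [u s N] := phiS y yX; split=> [||i /(chiX y yX)/pN il].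
  - rewrite /chi yX map_inj_in_uniq // => i j ip jp /eqP.
    by rewrite nth_uniq ?ps ?N // => /eqP.
  - by rewrite /chi yX size_map.
  - by apply: leq_trans le.
have [yX|yX] := boolP (y \in X); have [zX|zX] := boolP (z \in X).
- rewrite /chi yX zX => /mapP[j jp ->]; apply/negP=> /mapP[l lp /eqP].
  have [_ _ Ny] := phiS y yX; have [_ _ Nz] := phiS z zX.
  rewrite nth_uniq ?ps ?(Ny j jp) ?(Nz l lp) // => /eqP jl; rewrite jl in jp.
  by have := phiC y z yX zX yz l jp; rewrite lp.
- move/(chiX y yX) => ix; rewrite /chi (negbTE zX).
  apply: (psiC x z (setU11 _ _) (inD z zS zX)) => //.
  by rewrite gsym (hom z x y) 1?gsym // inE zX.
- rewrite {1}/chi (negbTE yX) => iy; apply/negP=> /(chiX z zX); apply/negP.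
  apply: (psiC y x (inD y yS yX) (setU11 _ _)) => //.
  by rewrite (hom y x z) // inE yX.
- rewrite /chi (negbTE yX) (negbTE zX); apply: psiC => //; exact: inD.
Qed.

Lemma omega_dyadic w (A : {set T}) k i : omega w A <= k -> {in A, forall x, 2 ^ i <= w x} ->
  omega (fun=> 1) A <= k %/ 2 ^ i.
Proof.
move=> Ak wA; apply: omega_leq => K KA Kc; rewrite leq_divRL ?expn_gt0 //.
apply: leq_trans Ak; apply: leq_trans (omega_geq w KA Kc).
rewrite /weight big_distrl /=; apply: leq_sum => x xK.
by rewrite mul1n wA // (subsetP KA).
Qed.

Lemma omega_adj w (A : {set T}) x y : x \in A -> y \in A -> e x y -> w x + w y <= omega w A.
Proof.
move=> xA yA xy; rewrite -(weight1 w x) -(weight1 w y).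
have xy1 : complete e [set x] [set y] by move=> a b /set1P-> /set1P->.
rewrite -(weightU _ xy1); apply: omega_geq; last by apply: clqU; rewrite ?clq1.
by rewrite subUset !sub1set xA.
Qed.

(** Vertices heavier than k / 2 are pairwise non-adjacent and take initial segments. Light class i
    owns the interval from k^c - B(i+1) to k^c - B(i), cut into blocks that a proper colouring of
    the class distributes. *)
Lemma set_coloring_prime S w : {in S, forall x, e v x} -> modular_prime e S ->
  exists phi, set_coloring S w (omega w S ^ degree) phi.
Proof.
move=> Sv prime; set k := omega w S; set c := degree.
pose d := prime_degree n; pose cls x := trunc_log 2 (w x).
pose U i := [set x in S | [&& 0 < w x, 2 * w x <= k & cls x == i]].
have chU i : chi e (U i) <= (k %/ 2 ^ i) ^ d.
  have US : U i \subset S by apply/subsetP=> x; rewrite inE => /andP[].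
  apply: leq_trans (chi_prime n_gt2 noC Sv prime US) _; apply: leq_expn.
  apply: (@omega_dyadic w); first exact: omegaS.
  move=> x; rewrite inE => /and4P[_ w0 _ /eqP<-].
  by case/andP: (trunc_log_bounds (ltnSn 1) w0).
have fE i : exists f : {ffun T -> 'I_#|T|.+1}, [forall x in U i, (f x < chi e (U i)) &&
    [forall y in U i, e x y ==> (f x != f y)]].
  by rewrite /chi; case: ex_minnP => m /existsP.
pose f i x : nat := xchoose (fE i) x.
have fU i x : x \in U i -> f i x < (k %/ 2 ^ i) ^ d.
  move=> xU; apply: leq_trans (chU i).
  by have /forall_inP/(_ x xU)/andP[] := xchooseP (fE i).
have fP i x y : x \in U i -> y \in U i -> e x y -> f i x != f i y.
  move=> xU yU xy; have /forall_inP/(_ x xU)/andP[_] := xchooseP (fE i).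
  by move=> /forall_inP/(_ y yU); rewrite xy.
pose b i := class_size k i ^ c; pose B i := budget d k i.
pose start x := k ^ c - B (cls x).+1 + f (cls x) x * b (cls x).
pose phi x := if k < 2 * w x then iota 0 (w x ^ c) else iota (start x) (w x ^ c).
have c0 : 0 < c by rewrite /c /degree /cexp addnS.
have Bk x : 0 < w x -> 2 * w x <= k -> B (cls x).+1 + (k - 2 ^ cls x) ^ c <= k ^ c.
  move=> w0 wk; apply: budget_leq; apply: leq_trans wk; rewrite leq_mul2l /=.
  by case/andP: (trunc_log_bounds (ltnSn 1) w0).
have inU x i j : x \in S -> i \in iota j (w x ^ c) -> ~~ (k < 2 * w x) ->
    [/\ 0 < w x, 2 * w x <= k & x \in U (cls x)].
  move=> xS ip; rewrite -leqNgt => wk.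
  have w0 : 0 < w x.
    by rewrite lt0n; apply: contraTneq ip => ->; rewrite exp0n.
  by split=> //; rewrite inE xS w0 wk /=.
have wb x : 0 < w x -> 2 * w x <= k -> w x ^ c <= b (cls x).
  move=> w0 wk; apply: leq_expn; rewrite /class_size leq_min.
  case/andP: (trunc_log_bounds (ltnSn 1) w0) => _ wl; rewrite (ltnW wl) /=.
  by move: wk; clear; lia.
have top x : 0 < w x -> 2 * w x <= k -> x \in U (cls x) ->
    start x + w x ^ c <= k ^ c - B (cls x).
  move=> w0 wk xU; have := Bk x w0 wk; have := wb x w0 wk; have := fU _ _ xU.
  have BS : B (cls x).+1 = B (cls x) + (k %/ 2 ^ cls x) ^ d * b (cls x).
    by rewrite /B /budget big_ord_recr.
  rewrite /start BS.
  set q := _ ^ d; set fx := f _ _; set bx := b _; set bu := B _; set r := (_ - _) ^ c.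
  move=> fq; have := leq_mul fq (leqnn bx); rewrite mulSn.
  by move: (fx * bx) (q * bx) (w x ^ c) (k ^ c); clear; lia.
exists phi; split=> [x xS|].
  rewrite /phi; split; first by case: ifP => _; apply: iota_uniq.
    by case: ifP => _; apply: size_iota.
  move=> i; case: ifPn => [_|wk ip].
    rewrite mem_iota add0n => /andP[_ iw]; apply: leq_trans iw _.
    by apply: leq_expn; apply: omega_geq1.
  have [w0 wk' xU] := inU x i _ xS ip wk; move: ip; rewrite mem_iota => /andP[_ iw].
  by apply: leq_trans iw _; apply: leq_trans (top x w0 wk' xU) (leq_subr _ _).
(* Adjacent weights sum to at most [k], so [x] weighs at most [k - 2 ^ cls y]; by [budget_leq] its
   segment ends below the interval of [y]. *)
have heavy_light x y i : x \in S -> y \in S -> e x y -> k < 2 * w x -> ~~ (k < 2 * w y) ->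
    i \in phi x -> i \in phi y -> False.
  move=> xS yS xy wx wy; rewrite /phi wx (negbTE wy) => ix iy.
  have [w0 wk yU] := inU y i _ yS iy wy; move: ix iy; rewrite !mem_iota add0n /start.
  case/andP=> _ ix /andP[iy _]; move: ix; rewrite ltnNge => /negP; apply.
  apply: leq_trans iy; apply: leq_trans (leq_addr _ _).
  have := Bk y w0 wk; have : w x ^ c <= (k - 2 ^ cls y) ^ c; last by clear; lia.
  apply: leq_expn; have := omega_adj w xS yS xy; rewrite -/k.
  by case/andP: (trunc_log_bounds (ltnSn 1) w0) => + _; rewrite -/(cls y); clear; lia.
have light x y i : x \in S -> y \in S -> e x y -> ~~ (k < 2 * w x) -> ~~ (k < 2 * w y) ->
    cls x <= cls y -> i \in phi x -> i \in phi y -> False.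
  move=> xS yS xy wx wy cxy; rewrite /phi (negbTE wx) (negbTE wy) => ix iy.
  have [w0 wk yU] := inU y i _ yS iy wy; have [v0 vk xU] := inU x i _ xS ix wx.
  move: ix iy; rewrite !mem_iota => /andP[x1 x2] /andP[y1 y2].
  move: cxy; rewrite leq_eqVlt => /orP[/eqP cxy|cxy]; last first.
    have := budgetS d k cxy; rewrite -/(B _) -/(B _).
    have := top y w0 wk yU; move: x1 y2; rewrite /start; clear; lia.
  rewrite -cxy in yU; have := fP _ _ _ xU yU xy.
  have := wb x v0 vk; have := wb y w0 wk; move: x1 x2 y1 y2; rewrite /start -cxy.
  set fx := f _ x; set fy := f _ y; move: (b _) (k ^ c - _) => bx s x1 x2 y1 y2 wy' wx'.
  rewrite neq_ltn => /orP[l|l].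
    have := leq_mul l (leqnn bx); rewrite mulSn; move: x2 y1 wx'.
    by move: (fx * bx) (fy * bx) (w x ^ c); clear; lia.
  have := leq_mul l (leqnn bx); rewrite mulSn; move: x1 y2 wy'.
  by move: (fx * bx) (fy * bx) (w y ^ c); clear; lia.
move=> x y xS yS xy i ix; apply/negP=> iy.
have [wx|wx] := boolP (k < 2 * w x); have [wy|wy] := boolP (k < 2 * w y).
- by have := omega_adj w xS yS xy; rewrite -/k; move: wx wy; clear; lia.
- exact: (heavy_light x y i).
- by apply: (heavy_light y x i); rewrite // gsym.
- have [l|/ltnW l] := leqP (cls x) (cls y); first exact: (light x y i).
  by apply: (light y x i); rewrite // gsym.
Qed.

(** Contracting [X] to one of its own vertices stays inside [S]: the smaller sets are still seen by
    [v], in the same graph. *)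
Lemma weighted_coloring S w : {in S, forall x, e v x} ->
  exists phi, set_coloring S w (omega w S ^ degree) phi.
Proof.
have [m] := ubnP #|S|; elim: m S w => // m IH S w Sm Sv.
have [pS|[X [XS X1 XS' hom]]] := prime_or_homogeneous S; first exact: set_coloring_prime.
have [x xX] : exists x, x \in X by apply/set0Pn; rewrite -card_gt0 ltnW.
have xS := subsetP XS x xX.
have XpS : X \proper S by rewrite properEneq XS' XS.
apply: (set_coloring_substitute XS xX hom) => [|w'].
  apply: IH; last by move=> y /(subsetP XS)/Sv.
  by apply: leq_trans (proper_card XpS) _.
apply: IH => [|y]; last by rewrite !inE => /orP[/eqP->|/andP[_]]; apply: Sv.
rewrite cardsU1 !inE xX /= add1n cardsD (setIidPr XS).
by move: Sm X1 (subset_leq_card XS); clear; lia.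
Qed.

Lemma chi_nbhd S : {in S, forall x, e v x} -> chi e S <= omega (fun=> 1) S ^ degree.
Proof.
move=> Sv; have [phi [phiS phiC]] := weighted_coloring (fun=> 1) Sv.
have mem x : x \in S -> head 0 (phi x) \in phi x.
  by case/phiS=> _; rewrite exp1n; case: (phi x) => // i s _ _; apply: mem_head.
apply: (chi_le (f := fun x => head 0 (phi x))) => [x xS|x y xS yS xy].
  by have [_ _] := phiS x xS; apply; apply: mem.
by apply: contraNneq (phiC x y xS yS xy _ (mem x xS)) => ->; apply: mem.
Qed.

End SetColorings.

(** * Vertex-minors *)

Definition graph_of (G : sgraph) : graph G := Graph (@adj_sym G) (@adj_irrefl G).

Section Transfer.
Variables (T : finType) (e : graph T) (G : sgraph) (h : T -> G).
Hypothesis h_inj : injective h.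
Hypothesis h_adj : forall x y, e x y = adj (h x) (h y).

(** Restriction to the image of [h] commutes with complementing at a vertex of that image. *)
Lemma foldl_lc_equivalent vs : exists2 G', locally_equivalent G G' &
  exists2 g : T -> G', injective g & forall x y, foldl (@lc T) e vs x y = adj (g x) (g y).
Proof.
elim/last_ind: vs => [|vs u [G' GG' [g gI gE]]]; first by exists G; [left | exists h].
exists (local_complement (g u)); first exact: locally_equivalent_step.
exists g => // x y; rewrite foldl_rcons [RHS]/= /local_complement_adj (inj_eq gI).
have [->|xy] := eqVneq x y; first by rewrite girr.
by rewrite lcE // !gE.
Qed.

Lemma has_cycle_vertex_minor n : has_cycle n e -> vertex_minor (cycle_graph n) G.
Proof.
case=> vs [f fI fE]; have [G' GG' [g gI gE]] := foldl_lc_equivalent vs.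
have gfI : injective (g \o f) by apply: inj_comp.
exists G' => //; exists [set (g \o f) i | i : 'I_n].
have mem i : (g \o f) i \in [set (g \o f) i | i : 'I_n] by apply: imset_f.
pose F i : {y | y \in [set (g \o f) i | i : 'I_n]} := Sub ((g \o f) i) (mem i).
exists (F : cycle_graph n -> induced _); last by move=> i j; rewrite /= -fE gE.
apply: inj_card_bij => [i j /(congr1 val)/gfI //|].
by rewrite card_sig card_imset.
Qed.
End Transfer.

Lemma chromatic_leq_chi (G : sgraph) : chromatic_number G <= chi (graph_of G) setT.
Proof.
rewrite /chromatic_number; case: ex_minnP => m _; apply.
have [f fk fP] := chiP (graph_of G) setT.
apply/existsP; exists [ffun x => Ordinal (fk x (in_setT x))].
apply/forallP=> x; apply/forallP=> y; apply/implyP=> xy.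
by rewrite !ffunE -val_eqE /= fP ?inE.
Qed.

Lemma omega_leq_clique_number (G : sgraph) :
  omega (graph_of G) (fun=> 1) setT <= clique_number G.
Proof.
apply: omega_leq => K _ Kc; rewrite /weight sum1_card.
exact: (@leq_bigmax_cond _ _ (fun K : {set G} => #|K|)).
Qed.

Lemma chi_cycle_free (T : finType) (e : graph T) n : 2 < n -> ~ has_cycle n e ->
  chi e setT <= chi_bound n (omega e (fun=> 1) setT ^ degree n).
Proof.
move=> n_gt2 noC; apply: chi_local => // x.
apply: leq_trans (chi_nbhd (v := x) n_gt2 noC _) _; first by move=> y; rewrite inE.
by apply: leq_expn; apply: omegaS; apply: subsetT.
Qed.

Import GRing.Theory Num.Theory.

Theorem theorem1p9 (n : nat) (hn : 3 <= n) :
  polynomially_chi_bounded (fun G : sgraph => ~ vertex_minor (cycle_graph n) G).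
Proof.
(* [c] and [d] are the slope and the constant term of the affine function [chi_bound n]. *)
pose c := 2 * n.+1 * (layer_path_bound n).+2.
pose d := 2 * (n.+1 * 2).+1.
exists ((c%:Z *: 'X^(degree n)) + d%:Z%:P)%R => G noG S.
rewrite !hornerE -[Posz (clique_number _)]natz -natrX natz -PoszM -PoszD lez_nat.
apply: leq_trans (chromatic_leq_chi _) _.
have noC : ~ has_cycle n (graph_of (induced S)).
  move/(@has_cycle_vertex_minor _ _ G val)=> h; apply: noG; apply: h => //; exact: val_inj.
apply: leq_trans (chi_cycle_free hn noC) _.
have := leq_expn (degree n) (omega_leq_clique_number (induced S)).
set r := omega _ _ _ ^ _; set q := clique_number _ ^ _ => rq.
apply: (@leq_trans (chi_bound n q)); last first.
  by rewrite /chi_bound /c /d; move: (layer_path_bound n) q {r rq} => L q; clear; nia.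
by rewrite /chi_bound !(leq_mul2l, leq_add2r, leq_add) ?leq_mul2l ?rq ?orbT.
Qed.
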